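(* For every $\delta > 0$ and $K \ge 0$ there exist finite constants $c_0 = c_0(\delta) > 0$, $N_0 = N_0(\delta, K) > 0$ and $s_0 = s_0(\delta, K) > 0$ such that $$\mathbf{P}\{\max\{Z^{z,\mathrm{hor}}(m,n), Z^{z,\mathrm{ver}}(m,n)\} \ge s(m+n)^{2/3}\} \le \exp\{-c_0 s^3\}$$ for all $(m,n) \in S_\delta \cap \mathbb{Z}_{\ge N_0}^2$, all $s \ge s_0$, and all $z \in (0,1)$ such that $|z - \zeta(m,n)| \le K(m+n)^{-1/3}$.
   Context: Notation $c = c(a,b)$ means that the constant depends only on the listed parameters. $X \sim \mathrm{Exp}(\lambda)$ means $X$ is exponential with rate $\lambda>0$ (mean $1/\lambda$). $[n] = \{1,\dots,n\}$. An up-right path is a finite sequence in $\mathbb{Z}^2$ with steps in $\{(1,0),(0,1)\}$; $\Pi_{p,q}^{m,n}$ is the set of up-right paths from $(p,q)$ to $(m,n)$. Let $\{\eta(i,j): i,j \in \mathbb{Z}_{\ge 0}\}$ be i.i.d. $\mathrm{Exp}(1)$ random variables on a probability space with measure $\mathbf{P}$. For $z \in (0,1)$ define weights $\hat\omega^{z}(0,0)=0$, $\hat\omega^z(i,j) = \eta(i,j)$ for $i,j>0$, $\hat\omega^z(i,0) = \eta(i,0)/z$ for $i>0$, $\hat\omega^z(0,j) = \eta(0,j)/(1-z)$ for $j>0$. For $(p,q),(m,n)\in\mathbb{Z}_{\ge0}^2$ let $\hat G^z_{p,q}(m,n) = \max_{\pi \in \Pi_{p,q}^{m,n}} \sum_{(i,j)\in\pi}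 \hat\omega^z(i,j)$, and $\hat G^z = \hat G^z_{0,0}$. When $p,q \ge 1$ write $G_{p,q}(m,n) = \hat G^z_{p,q}(m,n)$ (it does not depend on $z$). Exit points: $Z^{z,\mathrm{hor}}(m,n) = \max\bigl(0, \max\{k \in [m]: \hat G^z(m,n) = \hat G^z(k,0) + G_{k,1}(m,n)\}\bigr)$, $Z^{z,\mathrm{ver}}(m,n) = \max\bigl(0, \max\{l \in [n]: \hat G^z(m,n) = \hat G^z(0,l) + G_{1,l}(m,n)\}\bigr)$, with $\max\emptyset = -\infty$. $S_\delta = \{(x,y)\in\mathbb{R}_{>0}^2: x \ge \delta y,\ y \ge \delta x\}$, and $\zeta(x,y) = \dfrac{\sqrt{x}}{\sqrt{x}+\sqrt{y}}$ for $x,y>0$. *)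

(* Defs.v *)
From HB Require Import structures.
From mathcomp Require Import all_boot all_order all_algebra.
From mathcomp Require Import all_classical all_reals all_analysis.

Set Implicit Arguments.
Unset Strict Implicit.
Unset Printing Implicit Defensive.

Import Order.TTheory GRing.Theory Num.Theory.
Import numFieldNormedType.Exports.

Local Open Scope classical_set_scope.
Local Open Scope ring_scope.

Section Probability.
Context (d : measure_display) (T : measurableType d) (R : realType).
Variable P : probability T R.

(* The two sides are compared on measurable sets only: both are total functions
   of an arbitrary set, with no meaning outside the sigma-algebra. *)
Definition exponential_rv (rate : R) (X : {RV P >-> R}) : Prop :=
  forall A : set R, measurable A -> distribution P X A = exponential_prob rate A.

Definition mutually_independent (I : eqType) (X : I -> {RV P >-> R}) : Prop :=
  forall (J : seq I) (A : I -> set R), uniq J -> (forall i, measurable (A i)) ->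
  P (\bigcap_(i in [set` J]) (X i @^-1` A i)) =
  (\prod_(i <- J) P (X i @^-1` A i))%E.

Definition iid_exponential (rate : R) (I : eqType) (X : I -> {RV P >-> R}) :
  Prop := mutually_independent X /\ forall i, exponential_rv rate (X i).

End Probability.

(* Up-right paths starting in the quadrant never leave it, so paths are taken
   over [nat * nat]. A path lists all its points, both endpoints included. *)
Definition up_right_step (u v : nat * nat) : bool :=
  (v == (u.1.+1, u.2)) || (v == (u.1, u.2.+1)).

Definition up_right_paths (u v : nat * nat) : set (seq (nat * nat)) :=
  [set p | exists s, [/\ p = u :: s, path up_right_step u s & last u s = v]].

Section LastPassage.
Context {R : realType}.

(* The maximum over the finite set of paths, as a supremum in the extended
   reals: it is attained when there is a path ([last_passage_attained]), and it
   is -oo, the maximum of the empty set, when there is none. *)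
Definition last_passage (w : nat * nat -> R) (u v : nat * nat) : \bar R :=
  ereal_sup [set (\sum_(x <- p) w x)%:E | p in up_right_paths u v].

Definition boundary_weight (eta : nat * nat -> R) (z : R) (x : nat * nat) : R :=
  match x with
  | (0%N, 0%N) => 0
  | (_.+1, 0%N) => eta x / z
  | (0%N, _.+1) => eta x / (1 - z)
  | (_.+1, _.+1) => eta x
  end.

(* When both coordinates of u are positive this is the bulk last-passage time
   G_u(v), which does not depend on z: exit_hor and exit_ver use it as such. *)
Definition Ghat (eta : nat * nat -> R) (z : R) (u v : nat * nat) : \bar R :=
  last_passage (boundary_weight eta z) u v.

(* The big maximum over nat is 0 on an empty range, which is the truncation
   max(0, _) of the exit points. *)
Definition exit_hor (eta : nat * nat -> R) (z : R) (m n : nat) : nat :=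
  (\max_(1 <= k < m.+1 | Ghat eta z (0, 0)%N (m, n)%N ==
     (Ghat eta z (0, 0)%N (k, 0)%N + Ghat eta z (k, 1)%N (m, n)%N)%E) k)%N.

Definition exit_ver (eta : nat * nat -> R) (z : R) (m n : nat) : nat :=
  (\max_(1 <= l < n.+1 | Ghat eta z (0, 0)%N (m, n)%N ==
     (Ghat eta z (0, 0)%N (0, l)%N + Ghat eta z (1, l)%N (m, n)%N)%E) l)%N.

Definition cone (delta : R) : set (R * R) :=
  [set q | [/\ 0 < q.1, 0 < q.2, delta * q.2 <= q.1 & delta * q.1 <= q.2]].

Definition zeta (x y : R) : R := Num.sqrt x / (Num.sqrt x + Num.sqrt y).

End LastPassage.

Lemma up_right_path_le (u : nat * nat) s : path up_right_step u s ->
  (u.1 <= (last u s).1)%N /\ (u.2 <= (last u s).2)%N.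
Proof.
elim: s u => [//|x s IH] u /= /andP[/orP[]/eqP-> /IH[/= h1 h2]]; split=> //.
  exact: ltnW.
exact: ltnW.
Qed.

Lemma finite_up_right_paths (u v : nat * nat) : finite_set (up_right_paths u v).
Proof.
have [k] := ubnP (v.1 + v.2 - (u.1 + u.2)); elim: k u => // k IH u lek.
have [->|/eqP neuv] := eqVneq u v.
  apply: (@sub_finite_set _ _ [set [:: v]]); last exact: finite_set1.
  move=> _ [[|x s] [-> //= /andP[st /up_right_path_le[h1 h2]] lst]].
  exfalso; move: st h1 h2; rewrite lst => /orP[]/eqP-> /=; rewrite ?ltnn //.
pose F x := cons u @` up_right_paths x v.
have [luv|nluv] := ltnP (u.1 + u.2) (v.1 + v.2); last first.
  apply: (@sub_finite_set _ _ set0); last exact: finite_set0.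
  move=> _ [[|x s] [_ //= ] /andP[st /up_right_path_le[h1 h2]] lst].
  exfalso; rewrite lst in h1 h2; have := leq_trans (leq_add h1 h2) nluv.
  by case/orP: st => /eqP-> /=; rewrite ?addSn ?addnS ltnn.
apply: (@sub_finite_set _ _ (F (u.1.+1, u.2) `|` F (u.1, u.2.+1))).
  move=> _ [[|x s] [-> //= /andP[st ps] lst]].
  by case/orP: st => /eqP xE; [left|right]; exists (x :: s) => //;
    exists s; rewrite -xE.
rewrite finite_setU; split; apply: finite_image; apply: IH => /=;
  by rewrite ?addSn ?addnS; apply: leq_trans (lek : (_ <= k)%N); exact: ltn_sub2l.
Qed.

Lemma last_passage_attained (R : realType) (w : nat * nat -> R) u v :
  up_right_paths u v !=set0 ->
  exists2 p, up_right_paths u v p & last_passage w u v = (\sum_(x <- p) w x)%:E.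
Proof.
move=> [p0 Pp0]; pose f (p : seq (nat * nat)) := \sum_(x <- p) w x.
have [l lE] := (finite_seqP _).1 (finite_up_right_paths u v).
have [p [Pp ub]] :
    exists p, up_right_paths u v p /\ forall q, up_right_paths u v q -> f q <= f p.
  have : exists2 p, p \in p0 :: l & forall q, q \in p0 :: l -> f q <= f p.
    elim: (l) => [|q l' [p pl ub]].
      by exists p0; rewrite ?mem_head// => q; rewrite inE => /eqP->.
    have [fpq|fqp] := leP (f p) (f q).
      exists q; first by rewrite !inE eqxx orbT.
      move=> r; rewrite !inE => /or3P[/eqP->|/eqP->//|rl].
        by rewrite (le_trans _ fpq)// ub// mem_head.
      by rewrite (le_trans _ fpq)// ub// inE rl orbT.
    exists p; first by move: pl; rewrite !inE => /orP[->|->]; rewrite ?orbT.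
    move=> r; rewrite !inE => /or3P[/eqP->|/eqP->|rl].
    - by rewrite ub// mem_head.
    - exact: ltW.
    - by rewrite ub// inE rl orbT.
  move=> [p pl ub]; exists p; split.
    by move: pl; rewrite inE => /orP[/eqP->//|pl]; rewrite lE.
  by move=> q; rewrite lE => /= ql; rewrite ub// inE ql orbT.
exists p => //; apply/eqP; rewrite eq_le; apply/andP; split.
  by apply: ge_ereal_sup => _ [q Pq <-]; rewrite lee_fin; exact: ub.
by apply: ereal_sup_ubound; exists p.
Qed.

(* Main.v *)
Require Import Defs.
From HB Require Import structures.
From mathcomp Require Import all_boot all_order all_algebra.
From mathcomp Require Import all_classical all_reals all_analysis.
From mathcomp Require Import measurable_realfun ring lra zify.
Set Implicit Arguments.
Unset Strict Implicit.
Unset Printing Implicit Defensive.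
Import Order.TTheory GRing.Theory Num.Theory.
Import numFieldNormedType.Exports.
Local Open Scope classical_set_scope.
Local Open Scope ring_scope.

(** Why the bound holds. Give the x-axis weights rate w and the y-axis weights
    rate 1 - z, with w and z free, and let G(w, z) be the last-passage time
    from the origin to (m, n). The stationary model is w = z.

    The moment generating function of G(w, z) is explicit at one point
    ([lpp_mgf]): E exp((w - z) G(w, z)) = (w / z)^m ((1 - z) / (1 - w))^n.
    Indeed G(w, z) is the sum of the y-axis weights and of the horizontal
    increments along the top row. Weighting the probability by exp((w - z) *
    sum of the y-axis weights) turns the rate 1 - z of the y-axis into 1 - w,
    which makes the boundary stationary with parameter w; by the Burke property
    ([burke_flip], propagated over the rectangle by [has_law_rectangle]) the
    increments along the top row are then i.i.d. of rate w, and their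
    exponential moment at w - z is (w / z)^m.

    By the mean value theorem ([mgf_mvt]) the logarithm of the right-hand side
    is (w - z) (m / c + n / (1 - c)) with c between w and z. The function m / c
    + n / (1 - c), the mean of the stationary time, is minimal at c = zeta(m,
    n) with value M = (sqrt m + sqrt n)^2, and it exceeds M by M (c - zeta)^2 /
    (c (1 - c)) ([stationary_meanE]). Put N = m + n. When the parameters lie at
    distance of order s N^(-1/3) from zeta, the exponential Markov inequality
    bounds by exp(- c s^3) the probability that G(w, z), w < z, falls below M
    by s^2 N^(1/3), and that G(u, v), v < u, exceeds M by s^2 N^(1/3), up to
    constant factors.

    These two tails contradict a large exit point ([exit_hor_comparison]). Take
    v < u < w < z. If the optimal path for the rates (z, 1 - z) leaves the
    x-axis at k or later, then lowering the x-axis rate to w only strengthens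
    its preference for the x-axis, so the optimal path for (w, z) collects at
    least S_k / w there, S_k being the sum of the first k unscaled axis
    weights. Lowering the rate further to u gains (1 / u - 1 / w) S_k: G(w, z)
    + (1 / u - 1 / w) S_k <= G(u, v). For k of order s N^(2/3) and parameters
    spaced by a small multiple of s N^(-1/3), the gain is of order s^2 N^(1/3),
    unless S_k is less than k / 4, which is exponentially unlikely in k >= s^3.
    Hence one of three events of probability at most exp(- c s^3) occurs
    ([exit_hor_tail], [exit_hor_cubic]). Exits through the y-axis reduce to
    exits through the x-axis by transposing the lattice ([exit_ver_swap]). *)

(** * Measures with a density *)

Section density.
Context d (T : measurableType d) (R : realType).
Variables (mu : {measure set T -> \bar R}) (h : T -> R).
Hypotheses (mh : measurable_fun setT h) (h0 : forall x, 0 <= h x).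
Local Open Scope ereal_scope.

Definition density_measure (A : set T) : \bar R := \int[mu]_(x in A) (h x)%:E.

Let density0 : density_measure set0 = 0.
Proof. exact: integral_set0. Qed.

Let density_ge0 A : 0 <= density_measure A.
Proof. by apply: integral_ge0 => x _; rewrite lee_fin. Qed.

Let density_sigma_additive : semi_sigma_additive density_measure.
Proof.
move=> F mF tF mUF; rewrite /density_measure; apply: cvg_toP.
  apply: ereal_nondecreasing_is_cvgn => m n mn.
  by apply: lee_sum_nneg_natr => // k _ _; exact: density_ge0.
rewrite ge0_integral_bigcup//=.
- by apply: measurable_funTS; exact/measurable_EFinP.
- by move=> x _; rewrite lee_fin.
Qed.

HB.instance Definition _ := isMeasure.Build _ _ _ density_measure
  density0 density_ge0 density_sigma_additive.

(** The same set function, bundled with the two hypotheses on the density: the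
    bundled form can be named outside the section. *)
Definition weighted_measure : {measure set T -> \bar R} := density_measure.

Import HBNNSimple.

Lemma ge0_integral_density (f : T -> \bar R) :
  measurable_fun setT f -> (forall x, 0 <= f x) ->
  \int[density_measure]_x f x = \int[mu]_x (f x * (h x)%:E).
Proof.
move=> mf f0; pose g := nnsfun_approx measurableT mf.
have mhE : measurable_fun setT (EFin \o h) by exact: measurableT_comp.
have mg n : measurable_fun setT (fun x => (g n x)%:E) by exact/measurable_EFinP.
transitivity (limn (fun n => \int[density_measure]_x (g n x)%:E)).
  rewrite -monotone_convergence//.
  - apply: eq_integral => x _; apply/esym/cvg_lim => //.
    exact: cvg_nnsfun_approx.
  - by move=> n x _; rewrite lee_fin.
  - by move=> x _ a b ab; rewrite lee_fin; exact/lefP/nd_nnsfun_approx.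
transitivity (limn (fun n => \int[mu]_x ((g n x)%:E * (h x)%:E))); last first.
  rewrite -monotone_convergence//.
  - apply: eq_integral => x _; apply/cvg_lim => //.
    by apply: cvgeZr => //; exact: cvg_nnsfun_approx.
  - by move=> n; exact: emeasurable_funM.
  - by move=> n x _; rewrite mule_ge0// lee_fin.
  - by move=> x _ a b ab; rewrite lee_wpmul2r ?lee_fin//;
      exact/lefP/nd_nnsfun_approx.
congr (limn _); apply/funext => n.
under [LHS]eq_integral do rewrite fimfunE -fsumEFin//.
have mi r : measurable_fun setT (fun x => (r * \1_(g n @^-1` [set r]) x)%:E).
  by apply/measurable_EFinP; apply: measurable_funM.
rewrite ge0_integral_fsum//; last first.
  by move=> r x _; rewrite nnfun_muleindic_ge0.
under [RHS]eq_integral => x _.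
  rewrite fimfunE -fsumEFin// ge0_mule_fsuml; last first.
    by move=> y; rewrite nnfun_muleindic_ge0.
  over.
rewrite ge0_integral_fsum//; last 2 first.
- by move=> r; exact: emeasurable_funM.
- by move=> r x _; rewrite mule_ge0 ?nnfun_muleindic_ge0// lee_fin.
apply: eq_fsbigr => r rg.
rewrite integralZl_indic_nnsfun// integral_indic// setIT.
under eq_integral do rewrite EFinM -muleA.
rewrite ge0_integralZl//; last 3 first.
- apply: emeasurable_funM => //; exact/measurable_EFinP.
- by move=> x _; rewrite mule_ge0 ?lee_fin.
- by move: rg; rewrite inE => -[t _ <-]; rewrite lee_fin.
congr (_ * _); rewrite [LHS]integral_mkcond.
by apply: eq_integral => x _; rewrite epatch_indic/= muleC.
Qed.

End density.

(** * Affine changes of variable *)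

Section affine.
Context (R : realType).
Local Notation leb := (@lebesgue_measure R).

Lemma lebesgue_measure_affine (k b : R) (A : set R) : 0 < k -> measurable A ->
  pushforward leb (fun x => k * x + b : measurableTypeR R) A = (k^-1%:E * leb A)%E.
Proof.
move=> k0 mA.
have ki0 : 0 <= k^-1 by rewrite invr_ge0 ltW.
have mf : measurable_fun [set: measurableTypeR R]
    (fun x : measurableTypeR R => k * x + b : measurableTypeR R).
  by apply: measurable_funD => //; exact: measurable_funM.
pose push : {measure set (measurableTypeR R) -> \bar R} :=
  measure_function_pushforward__canonical__measure_function_Measure leb mf.
suff : leb A = mscale (NngNum (ltW k0)) push A.
  move=> ->; rewrite /mscale/= muleA -EFinM mulVf ?gt_eqF// mul1e//.
apply: lebesgue_measure_unique => // _ [[a c]] _ <-.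
pose J : set R := `](a - b) / k, (c - b) / k]%classic.
transitivity (k%:E * leb J)%E; last first.
  congr (_ * leb _)%E; apply/seteqP; split => x;
  by rewrite /J/= !in_itv/= ltr_pdivrMr// ler_pdivlMr// ltrBlDr lerBrDr mulrC.
rewrite /J !lebesgue_measure_itv/= !lte_fin.
rewrite ltr_pM2r ?invr_gt0// ltrD2r; case: ifPn => _; last by rewrite mule0.
by rewrite -!EFinD -EFinM; congr EFin; field; rewrite gt_eqF.
Qed.

Lemma ge0_integral_affine (k b : R) (f : R -> \bar R) : 0 < k ->
  measurable_fun setT f -> (forall x, 0 <= f x)%E ->
  (\int[leb]_x f (k * x + b)%R = k^-1%:E * \int[leb]_x f x)%E.
Proof.
move=> k0 mf f0.
have ki0 : 0 <= k^-1 by rewrite invr_ge0 ltW.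
have mF : measurable_fun [set: measurableTypeR R]
    (fun x : measurableTypeR R => k * x + b : measurableTypeR R).
  by apply: measurable_funD => //; exact: measurable_funM.
have := @ge0_integral_pushforward _ _ _ _ _ _ mF leb setT f measurableT mf
  (fun y _ => f0 y).
rewrite preimage_setT => <-.
rewrite -(@ge0_integral_mscale _ _ _ leb setT measurableT (NngNum ki0))//.
by apply: eq_measure_integral => A mA _; rewrite [LHS]lebesgue_measure_affine.
Qed.

End affine.

(** * Exponential laws *)

Section exponential_law.
Context (R : realType).
Local Notation leb := (@lebesgue_measure R).
Local Notation pdf := (@exponential_pdf R).

Definition exponential_law (r : R) (r0 : 0 < r) : probability (measurableTypeR R) R :=
  exponential_distribution_exponential_prob__canonical__probability_measure_Probability r0.

Lemma exponential_lawE r (r0 : 0 < r) (A : set R) :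
  exponential_law r0 A = exponential_prob r A.
Proof. by []. Qed.

Lemma ge0_integral_exponential_law r (r0 : 0 < r) (f : R -> \bar R) :
  measurable_fun setT f -> (forall x, 0 <= f x)%E ->
  (\int[exponential_law r0]_x f x = \int[leb]_x (f x * (pdf r x)%:E))%E.
Proof.
move=> mf f0.
have mp := measurable_exponential_pdf r.
have p0 x : 0 <= pdf r x by rewrite exponential_pdf_ge0// ltW.
rewrite -(ge0_integral_density leb mp p0 mf f0).
exact: eq_measure_integral.
Qed.

Lemma exponential_probE (r : R) (A : set R) : 0 < r -> measurable A ->
  exponential_prob r A = (\int[leb]_x ((\1_A x)%:E * (pdf r x)%:E))%E.
Proof.
move=> r0 mA; rewrite [LHS]integral_mkcond.
by apply: eq_integral => x _; rewrite epatch_indic/= muleC.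
Qed.

Lemma exponential_prob_fin (r : R) A : 0 < r -> measurable A ->
  exponential_prob r A \is a fin_num.
Proof.
move=> r0 mA; rewrite -(exponential_lawE r0); exact: fin_num_measure.
Qed.

Lemma exponential_prob_setT (r : R) : 0 < r -> exponential_prob r [set: R] = 1%E.
Proof. by move=> r0; exact: (@probability_setT _ _ _ (exponential_law r0)). Qed.

Lemma exponential_prob_ge0 (r : R) A : 0 < r -> (0 <= exponential_prob r A)%E.
Proof. by move=> r0; exact: (@measure_ge0 _ _ _ (exponential_law r0)). Qed.

(** Dividing by the rate is how the boundary weights are built from a common
    rate-1 field, so this is what makes them exponential of the right rate. *)
Lemma exponential_prob_scale (r : R) (A : set R) : 0 < r -> measurable A ->
  exponential_prob 1 ((fun x => x / r) @^-1` A) = exponential_prob r A.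
Proof.
move=> r0 mA.
have mp := @measurable_exponential_pdf R r.
have mdiv : measurable_fun setT (fun x : R => x / r) by exact: measurable_funM.
have mB : measurable ((fun x => x / r) @^-1` A).
  by rewrite -[X in measurable X]setTI; exact: mdiv.
rewrite (exponential_probE r0 mA) (exponential_probE ltr01 mB).
pose g x := ((\1_A x)%:E * (pdf r x)%:E)%E.
have g0 x : (0 <= g x)%E by rewrite mule_ge0// lee_fin exponential_pdf_ge0// ltW.
have mg : measurable_fun setT g.
  by apply: emeasurable_funM; exact/measurable_EFinP.
have ri : 0 < r^-1 by rewrite invr_gt0.
have gE := ge0_integral_affine 0 ri mg g0; rewrite invrK in gE.
have ri0 : (0 <= r^-1)%R by rewrite invr_ge0 ltW.
transitivity (r^-1%:E * \int[leb]_x g (r^-1 * x + 0)%R)%E; last first.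
  by rewrite gE muleA -EFinM mulVf ?gt_eqF// mul1e.
rewrite -ge0_integralZl//; last first.
  by apply: measurableT_comp => //; apply: measurable_funD => //; exact: measurable_funM.
apply: eq_integral => x _; rewrite /g addr0 muleCA [r^-1 * x]mulrC.
congr (_ * _)%E; rewrite -EFinM; congr EFin.
have [x0|x0] := ltP x 0.
  by rewrite !lt0_exponential_pdf ?mulr0// pmulr_llt0// invr_gt0.
rewrite !exponential_pdfE ?divr_ge0 ?(ltW r0)//.
rewrite mul1r mulrA mulVf ?gt_eqF// mul1r; congr expR.
by field; rewrite gt_eqF.
Qed.

(** The density at x times exp (a x) is again an exponential density, of rate r
    - a, up to the constant r / (r - a): this is the change of measure that
    moves the rate of a boundary. *)
Lemma exponential_law_tilt (r : R) (r0 : 0 < r) (a : R) (A : set R) :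
  a < r -> measurable A ->
  (\int[exponential_law r0]_x (\1_A x * expR (a * x))%:E =
    (r / (r - a))%:E * exponential_prob (r - a) A)%E.
Proof.
move=> ar mA; have ra0 : 0 < r - a by rewrite subr_gt0.
have me : measurable_fun setT (fun x : R => expR (a * x)).
  by apply: measurableT_comp => //; exact: measurable_funM.
rewrite ge0_integral_exponential_law//; last first.
  by apply/measurable_EFinP; apply: measurable_funM.
rewrite exponential_probE// -ge0_integralZl//; last 3 first.
- by apply: emeasurable_funM; apply/measurable_EFinP => //;
    exact: measurable_exponential_pdf.
- by move=> x _; rewrite mule_ge0// lee_fin exponential_pdf_ge0// ltW.
- by rewrite lee_fin divr_ge0// ltW.
apply: eq_integral => x _; rewrite -!EFinM; congr EFin.
have [x0|x0] := ltP x 0; first by rewrite !lt0_exponential_pdf ?mulr0//.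
rewrite !exponential_pdfE//.
rewrite (_ : - (r - a) * x = a * x + (- r * x)); last by ring.
by rewrite expRD; field; rewrite gt_eqF.
Qed.

End exponential_law.

(** * The Burke property at one vertex *)

Section burke_local.
Context (R : realType).
Local Notation leb := (@lebesgue_measure R).
Local Notation pdf := (@exponential_pdf R).
Local Notation Rm := (measurableTypeR R).
Local Notation law := exponential_law.
Local Open Scope ereal_scope.

(** As a sub-probability the product is sigma-finite, which Tonelli's theorem
    needs in order to iterate it once more. *)
Definition exponential_law2 (a b : R) (a0 : (0 < a)%R) (b0 : (0 < b)%R) :=
  product_subprobability
    (exponential_law a0 : subprobability Rm R, exponential_law b0 : subprobability Rm R).

Lemma exponential_law2E a b (a0 : (0 < a)%R) (b0 : (0 < b)%R) (f : Rm * Rm -> \bar R) :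
  measurable_fun setT f -> (forall p, 0 <= f p) ->
  \int[exponential_law2 a0 b0]_p f p = \int[law a0]_x \int[law b0]_y f (x, y).
Proof. by move=> mf f0; exact: fubini_tonelli1. Qed.

Lemma exponential_law2_swap a b (a0 : (0 < a)%R) (b0 : (0 < b)%R) (f : Rm * Rm -> \bar R) :
  measurable_fun setT f -> (forall p, 0 <= f p) ->
  \int[exponential_law2 a0 b0]_p f p = \int[exponential_law2 b0 a0]_p f (p.2, p.1).
Proof.
move=> mf f0.
have ms : measurable_fun setT (fun p : Rm * Rm => f (p.2, p.1)).
  by apply: (measurableT_comp mf); apply/measurable_fun_pairP; split;
    exact: measurable_snd || exact: measurable_fst.
rewrite [RHS]exponential_law2E//.
exact: fubini_tonelli2.
Qed.

Variables (a b : R) (a0 : (0 < a)%R) (b0 : (0 < b)%R) (ab1 : (a + b = 1)%R).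
Let Pab := exponential_law2 a0 b0.

(** Substitute u = w + x - y. On the support w <= u of h, and for y and w
    nonnegative, the product of the densities at (x, y, w) equals the product
    of the densities of rates a, 1, b at (u, y, w): both are a b exp (- a u - y
    - b w), because a + b = 1. *)
Lemma exponential_law_shift (h : Rm * Rm -> \bar R) (w y : R) :
  measurable_fun setT h -> (forall p, 0 <= h p) ->
  (forall u v : R, (u < v)%R -> h (u, v) = 0) ->
  (pdf 1 w)%:E * ((\int[law a0]_x h (w + (x - y), w)%R) * (pdf b y)%:E) =
  (pdf b w)%:E * (\int[law a0]_u h (u, w)) * (pdf 1 y)%:E.
Proof.
move=> mh h0 hlt.
have mhw : measurable_fun setT (fun u : Rm => h (u, w)) by exact: measurableT_comp.
have mpa := measurable_exponential_pdf a.
have maff : measurable_fun setT (fun x : Rm => w + (x - y) : Rm)%R.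
  by apply: measurable_funD => //; exact: measurable_funB.
have pge0 r x : (0 < r)%R -> 0 <= (pdf r x)%:E.
  by move=> r0; rewrite lee_fin exponential_pdf_ge0// ltW.
rewrite !ge0_integral_exponential_law//; last first.
  exact: (measurableT_comp mhw maff).
have mk : measurable_fun setT
    (fun u : Rm => h (u, w) * (pdf a (u + (y - w))%R)%:E).
  apply: emeasurable_funM => //; apply/measurable_EFinP.
  by apply: (measurableT_comp mpa); exact: measurable_funD.
have -> : \int[leb]_x (h ((w + (x - y))%R, w) * (pdf a x)%:E) =
    \int[leb]_u (h (u, w) * (pdf a (u + (y - w))%R)%:E).
  have k0 u : 0 <= h (u, w) * (pdf a (u + (y - w))%R)%:E.
    by rewrite mule_ge0// pge0.
  have := ge0_integral_affine (w - y) ltr01 mk k0.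
  rewrite invr1 mul1e => <-; apply: eq_integral => x _.
  by rewrite mul1r; congr (h (_, _) * (pdf _ _)%:E); ring.
rewrite -ge0_integralZr//; last 2 first.
- by move=> u _; rewrite mule_ge0// pge0.
- exact: pge0.
rewrite -ge0_integralZl//; last 3 first.
- by apply: emeasurable_funM.
- by move=> u _; rewrite !mule_ge0// pge0.
- exact: pge0.
rewrite -ge0_integralZl//; last 3 first.
- by apply: emeasurable_funM => //; exact/measurable_EFinP.
- by move=> u _; rewrite !mule_ge0// pge0.
- exact: pge0.
rewrite -(ge0_integralZr _ measurableT); last 3 first.
- by apply: emeasurable_funM => //; apply: emeasurable_funM => //; exact/measurable_EFinP.
- by move=> u _; rewrite !mule_ge0// pge0.
- exact: pge0.
apply: eq_integral => u _.
have [uw|wu] := ltP u w; first by rewrite hlt// !(mul0e, mule0).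
have [y0|y0] := ltP y 0%R.
  by rewrite (lt0_exponential_pdf b y0) (lt0_exponential_pdf 1 y0) !mule0.
have [w0|w0] := ltP w 0%R.
  by rewrite (lt0_exponential_pdf b w0) (lt0_exponential_pdf 1 w0) !mul0e.
rewrite -!muleA [LHS]muleCA [RHS]muleCA -!EFinM; congr (_ * _%:E).
rewrite !exponential_pdfE//; last 2 first.
- exact: le_trans wu.
- by lra.
rewrite -ab1.
rewrite (_ : - a * (u + (y - w)) = - a * u + - a * y + a * w)%R; last by ring.
rewrite (_ : - (a + b) * w = - a * w + - b * w)%R; last by ring.
rewrite (_ : - (a + b) * y = - a * y + - b * y)%R; last by ring.
rewrite !expRD mulNr expRN; field.
by rewrite gt_eqF// expR_gt0.
Qed.

(** When y <= x the vertex map sends (w, x, y) to (w + (x - y), w), which lies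
    in the half-plane below the diagonal; this is the part of the Burke
    property that concerns this half-plane. Integrate [exponential_law_shift]
    over y, where the density of rate 1 integrates to 1. *)
Lemma exponential_law_half (h : Rm * Rm -> \bar R) :
  measurable_fun setT h -> (forall p, 0 <= h p) ->
  (forall u v : R, (u < v)%R -> h (u, v) = 0) ->
  \int[law ltr01]_w \int[Pab]_p h (w + (p.1 - p.2), w)%R = \int[Pab]_p h p.
Proof.
move=> mh h0 hlt.
have mpb := measurable_exponential_pdf b.
have mp1 := measurable_exponential_pdf (1 : R).
have pge0 r x : (0 < r)%R -> 0 <= (pdf r x)%:E.
  by move=> r0; rewrite lee_fin exponential_pdf_ge0// ltW.
have mshift : measurable_fun setT
    (fun q : Rm * (Rm * Rm) => (q.1 + (q.2.1 - q.2.2))%R : Rm).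
  apply: measurable_funD => //; apply: measurable_funB.
    by apply: (measurableT_comp measurable_fst); exact: measurable_snd.
  by apply: (measurableT_comp measurable_snd); exact: measurable_snd.
have mH : measurable_fun setT
    (fun q : Rm * (Rm * Rm) => h ((q.1 + (q.2.1 - q.2.2))%R, q.1)).
  by apply: (measurableT_comp mh); apply/measurable_fun_pairP;
    split; [exact: mshift|exact: measurable_fst].
have mHw w : measurable_fun setT (fun p : Rm * Rm => h ((w + (p.1 - p.2))%R, w)).
  exact: (measurableT_comp mH (pair1_measurable w)).
pose H := fun w : R => \int[law a0]_u h (u, w).
have mHH : measurable_fun setT H by exact: measurable_fun_fubini_tonelli_G.
have H0 w : 0 <= H w by exact: integral_ge0.
rewrite ge0_integral_exponential_law//; last 2 first.
- exact: (measurable_fun_fubini_tonelli_F (m2 := Pab) _ mH).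
- by move=> w; exact: integral_ge0.
transitivity (\int[leb]_w (H w * (pdf b w)%:E)); last first.
  rewrite -(ge0_integral_exponential_law b0)//.
  by symmetry; exact: fubini_tonelli2.
apply: eq_integral => w _.
have -> : \int[Pab]_p h ((w + (p.1 - p.2))%R, w) =
    \int[law b0]_y \int[law a0]_x h ((w + (x - y))%R, w).
  exact: (fubini_tonelli2 _ (mHw w)).
have mG : measurable_fun setT (fun y : Rm => \int[law a0]_x h ((w + (x - y))%R, w)).
  exact: (measurable_fun_fubini_tonelli_G _ (mHw w)).
rewrite ge0_integral_exponential_law//; last by move=> y; exact: integral_ge0.
rewrite muleC -ge0_integralZl//; last 3 first.
- by apply: emeasurable_funM => //; exact/measurable_EFinP.
- by move=> y _; rewrite mule_ge0// ?pge0//; exact: integral_ge0.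
- exact: pge0.
under eq_integral do rewrite exponential_law_shift//.
rewrite ge0_integralZl//; last 3 first.
- exact/measurable_EFinP.
- by move=> y _; exact: pge0.
- by apply: mule_ge0; [exact: pge0|exact: H0].
by rewrite integral_exponential_pdf// mule1 muleC.
Qed.
End burke_local.

Section burke.
Context (R : realType).
Local Notation Rm := (measurableTypeR R).
Local Notation law := exponential_law.
Local Open Scope ereal_scope.
Variables (a b : R) (a0 : (0 < a)%R) (b0 : (0 < b)%R) (ab1 : (a + b = 1)%R).
Let Pab := exponential_law2 a0 b0.
Let Pba := exponential_law2 b0 a0.

(** The Burke property in integral form: for independent exponential x, y, w of
    rates a, b and 1 = a + b, the pair (w + (x - y)^+, w + (y - x)^+) has the
    law of (x, y). Cut the plane along the diagonal and apply
    [exponential_law_half] on each side, exchanging the roles of x and y above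
    the diagonal. *)
Lemma exponential_law_burke (f : Rm * Rm -> \bar R) :
  measurable_fun setT f -> (forall p, 0 <= f p) ->
  \int[law ltr01]_w \int[Pab]_p
     f (w + Num.max 0 (p.1 - p.2), w + Num.max 0 (p.2 - p.1))%R =
  \int[Pab]_p f p.
Proof.
move=> mf f0.
have m1 : measurable_fun setT (fun q : Rm * Rm => q.1) by exact: measurable_fst.
have m2 : measurable_fun setT (fun q : Rm * Rm => q.2) by exact: measurable_snd.
pose f1 (q : Rm * Rm) := if (q.2 <= q.1 :> R)%R then f q else 0.
pose f2 (q : Rm * Rm) := if (q.1 < q.2 :> R)%R then f q else 0.
pose h2 (q : Rm * Rm) := f2 (q.2, q.1).
have mf1 : measurable_fun setT f1.
  by apply: measurable_fun_ifT => //; exact: measurable_fun_ler.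
have mf2 : measurable_fun setT f2.
  by apply: measurable_fun_ifT => //; exact: measurable_fun_ltr.
have mh2 : measurable_fun setT h2.
  by apply: (measurableT_comp mf2); apply/measurable_fun_pairP; split.
have f10 q : 0 <= f1 q by rewrite /f1; case: ifP.
have f20 q : 0 <= f2 q by rewrite /f2; case: ifP.
have h20 q : 0 <= h2 q by exact: f20.
have mshift : measurable_fun setT
    (fun q : Rm * (Rm * Rm) => (q.1 + (q.2.1 - q.2.2))%R : Rm).
  apply: measurable_funD => //; apply: measurable_funB.
    by apply: (measurableT_comp measurable_fst); exact: measurable_snd.
  by apply: (measurableT_comp measurable_snd); exact: measurable_snd.
have mS (h : Rm * Rm -> \bar R) : measurable_fun setT h ->
    measurable_fun setT (fun q : Rm * (Rm * Rm) => h ((q.1 + (q.2.1 - q.2.2))%R, q.1)).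
  move=> mh; apply: (measurableT_comp mh); apply/measurable_fun_pairP.
  by split; [exact: mshift|exact: measurable_fst].
have mSw (h : Rm * Rm -> \bar R) w : measurable_fun setT h ->
    measurable_fun setT (fun p : Rm * Rm => h ((w + (p.1 - p.2))%R, w)).
  by move=> /mS mh; exact: (measurableT_comp mh (pair1_measurable w)).
have msw : measurable_fun setT (fun p : Rm * Rm => (p.2, p.1)).
  by apply/measurable_fun_pairP; split.
have fE (w : R) (p : Rm * Rm) :
    f (w + Num.max 0 (p.1 - p.2), w + Num.max 0 (p.2 - p.1))%R =
    f1 ((w + (p.1 - p.2))%R, w) + h2 ((w + (p.2 - p.1))%R, w).
  rewrite /h2 /f1 /f2/=; have [le|lt] := leP p.2 p.1.
    rewrite (max_r (_ : 0 <= p.1 - p.2)%R) ?subr_ge0//.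
    rewrite (max_l (_ : p.2 - p.1 <= 0)%R) ?subr_le0// addr0.
    rewrite ifT; last by rewrite lerDl subr_ge0.
    by rewrite ifF ?adde0//; apply/negP; rewrite ltrDl subr_gt0 ltNge le.
  rewrite (max_l (_ : p.1 - p.2 <= 0)%R) ?subr_le0 ?(ltW lt)//.
  rewrite (max_r (_ : 0 <= p.2 - p.1)%R) ?subr_ge0 ?(ltW lt)// addr0.
  rewrite ifF; last by apply/negP; rewrite lerDl subr_ge0 leNgt lt.
  by rewrite ifT ?add0e// ltrDl subr_gt0.
transitivity (\int[law ltr01]_w ((\int[Pab]_p f1 (w + (p.1 - p.2), w)%R) +
    \int[Pba]_p h2 (w + (p.1 - p.2), w)%R)).
  apply: eq_integral => w _.
  transitivity (\int[Pab]_p (f1 (w + (p.1 - p.2), w)%R + h2 (w + (p.2 - p.1), w)%R)).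
    by apply: eq_integral => p _; exact: fE.
  have mh2s : measurable_fun setT (fun p : Rm * Rm => h2 ((w + (p.2 - p.1))%R, w)).
    exact: (measurableT_comp (mSw _ w mh2) msw).
  have m1s := mSw _ w mf1.
  have D := @ge0_integralD _ _ R Pab setT measurableT _ _ (fun p _ => f10 _) m1s
    (fun p _ => h20 _) mh2s.
  have S : \int[Pab]_p h2 (w + (p.2 - p.1), w)%R = \int[Pba]_p h2 (w + (p.1 - p.2), w)%R.
    exact: (exponential_law2_swap a0 b0 mh2s (fun p => h20 _)).
  exact: (eq_trans D (congr1
    (fun I => \int[Pab]_p f1 (w + (p.1 - p.2), w)%R + I) S)).
rewrite (ge0_integralD _ measurableT
  (fun w _ => integral_ge0 _ (fun p _ => f10 _))
  (measurable_fun_fubini_tonelli_F (m2 := Pab) _ (mS _ mf1) (fun p => f10 _))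
  (fun w _ => integral_ge0 _ (fun p _ => h20 _))
  (measurable_fun_fubini_tonelli_F (m2 := Pba) _ (mS _ mh2) (fun p => h20 _))).
have f1lt (u v : R) : (u < v)%R -> f1 (u, v) = 0.
  by move=> uv; rewrite /f1/= leNgt uv.
have h2lt (u v : R) : (u < v)%R -> h2 (u, v) = 0.
  by move=> uv; rewrite /h2/f2/= ltNge (ltW uv).
have ba1 : (b + a = 1)%R by rewrite addrC.
have H1 := exponential_law_half a0 b0 ab1 mf1 f10 f1lt.
have H2 := exponential_law_half b0 a0 ba1 mh2 h20 h2lt.
have H3 := exponential_law2_swap a0 b0 mf2 f20.
have D := @ge0_integralD _ _ R Pab setT measurableT _ _ (fun p _ => f10 p) mf1
  (fun p _ => f20 p) mf2.
apply: (eq_trans (f_equal2 (fun x y => x + y) H1 (eq_trans H2 (esym H3)))).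
apply: (eq_trans (esym D)).
apply: eq_integral => p _; rewrite /f1 /f2.
by case: leP => _; rewrite ?adde0 ?add0e.
Qed.

End burke.

(** * From product events to joint laws *)

Section scaled.
Context d (T : measurableType d) (R : realType) (P : probability T R) (k : {nonneg R}).
Local Open Scope ereal_scope.

Definition scaled_probability : set T -> \bar R := mscale k P.

HB.instance Definition _ := Measure.on scaled_probability.

Let scaled_fin : fin_num_fun scaled_probability.
Proof.
by move=> A mA; rewrite /scaled_probability /mscale/= fin_numM// fin_num_measure.
Qed.

HB.instance Definition _ := Measure_isFinite.Build _ _ _ scaled_probability scaled_fin.

Lemma ge0_integral_scaled_probability (f : T -> \bar R) : measurable_fun setT f ->
  (forall x, 0 <= f x) ->
  \int[scaled_probability]_x f x = k%:num%:E * \int[P]_x f x.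
Proof. by move=> mf f0; exact: ge0_integral_mscale. Qed.
End scaled.

Section indep_law.
Local Open Scope ereal_scope.
Context d d1 d2 (T : measurableType d) (T1 : measurableType d1) (T2 : measurableType d2)
  (R : realType) (Q : {measure set T -> \bar R}).
Variables (X : T -> T1) (Y : T -> T2).
Hypotheses (mX : measurable_fun setT X) (mY : measurable_fun setT Y).
Variables (P1 : probability T1 R) (P2 : subprobability T2 R) (k : {nonneg R}).
Hypothesis lawXY : forall A B, measurable A -> measurable B ->
  Q (X @^-1` A `&` Y @^-1` B) = k%:num%:E * (P1 A * P2 B).

Let mXY : measurable_fun setT (fun t => (X t, Y t)).
Proof. by apply/measurable_fun_pairP; split. Qed.

Let scaled_product (D : set (T1 * T2)) : measurable D ->
  (scaled_probability P1 k \x P2) D = k%:num%:E * (P1 \x P2) D.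
Proof.
move=> mD; rewrite /product_measure1/= ge0_integral_scaled_probability//.
exact: measurable_fun_xsection.
Qed.

(** The mass k allows Q to be the restriction of a measure to an event that is
    independent of (X, Y); independence of further variables is then carried
    along in that event. *)
Lemma joint_law (D : set (T1 * T2)) : measurable D ->
  Q ((fun t => (X t, Y t)) @^-1` D) = k%:num%:E * (P1 \x P2) D.
Proof.
move=> mD.
pose m' : {measure set (T1 * T2) -> \bar R} :=
  measure_function_pushforward__canonical__measure_function_Measure Q mXY.
transitivity ((scaled_probability P1 k \x P2) D).
  symmetry; apply: (product_measure_unique (m' := m')) => // A B mA mB.
  transitivity (Q (X @^-1` A `&` Y @^-1` B)) => //.
  by rewrite lawXY// muleA.
exact: scaled_product.
Qed.

Lemma ge0_integral_joint_law (f : T1 * T2 -> \bar R) : measurable_fun setT f ->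
  (forall p, 0 <= f p) ->
  \int[Q]_t f (X t, Y t) = k%:num%:E * \int[P1]_x \int[P2]_y f (x, y).
Proof.
move=> mf f0.
pose m' : {measure set (T1 * T2) -> \bar R} :=
  measure_function_pushforward__canonical__measure_function_Measure Q mXY.
transitivity (\int[m']_p f p).
  symmetry; exact: (ge0_integral_pushforward mXY Q measurableT mf (fun y _ => f0 y)).
transitivity (\int[scaled_probability P1 k \x P2]_p f p).
  apply: eq_measure_integral => D mD _.
  exact: (eq_trans (joint_law mD) (esym (scaled_product mD))).
rewrite fubini_tonelli1// ge0_integral_scaled_probability//.
  exact: measurable_fun_fubini_tonelli_F.
by move=> x; exact: integral_ge0.
Qed.
End indep_law.

Section burke_flip.
Local Open Scope ereal_scope.
Context d (T : measurableType d) (R : realType) (Q : {measure set T -> \bar R}).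
Variables (X Y W : T -> R) (a b : R) (k : {nonneg R}).
Hypotheses (mX : measurable_fun setT X) (mY : measurable_fun setT Y)
  (mW : measurable_fun setT W).
Hypotheses (a0 : (0 < a)%R) (b0 : (0 < b)%R) (ab1 : (a + b = 1)%R).
Hypothesis lawXYW : forall A B C : set R, measurable A -> measurable B -> measurable C ->
  Q (X @^-1` A `&` Y @^-1` B `&` W @^-1` C) =
  k%:num%:E * (exponential_prob a A * exponential_prob b B * exponential_prob 1 C).

Local Notation Rm := (measurableTypeR R).

(** The Burke property for random variables. [joint_law] is used twice: the
    inner use fixes an event of W and identifies the law of (X, Y) under the
    restricted measure, the outer one adds W. *)
Lemma burke_flip (A B : set R) : measurable A -> measurable B ->
  Q ((fun t => W t + Num.max 0 (X t - Y t))%R @^-1` A `&`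
     (fun t => W t + Num.max 0 (Y t - X t))%R @^-1` B) =
  k%:num%:E * (exponential_prob a A * exponential_prob b B).
Proof.
move=> mA mB.
have mAB : measurable (A `*` B : set (Rm * Rm)) by exact: measurableX.
have e0 r (C : set R) : (0 < r)%R -> 0 <= exponential_prob r C.
  by move=> r0; exact: exponential_prob_ge0.
have mW1 (C : set R) : measurable C -> measurable (W @^-1` C).
  by move=> mC; rewrite -[X in measurable X]setTI; exact: mW.
have mXY : measurable_fun setT (fun t => (X t, Y t) : Rm * Rm).
  by apply/measurable_fun_pairP; split.
pose f (p : Rm * Rm) : \bar R := (\1_(A `*` B) p)%:E.
have f0 p : 0 <= f p by rewrite lee_fin.
have mf : measurable_fun setT f by exact/measurable_EFinP.
pose g (q : Rm * (Rm * Rm)) : \bar R :=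
  f (q.1 + Num.max 0 (q.2.1 - q.2.2), q.1 + Num.max 0 (q.2.2 - q.2.1))%R.
have m21 : measurable_fun setT (fun q : Rm * (Rm * Rm) => q.2.1 : R).
  by apply: (measurableT_comp measurable_fst); exact: measurable_snd.
have m22 : measurable_fun setT (fun q : Rm * (Rm * Rm) => q.2.2 : R).
  by apply: (measurableT_comp measurable_snd); exact: measurable_snd.
have m1 : measurable_fun setT (fun q : Rm * (Rm * Rm) => q.1 : R).
  exact: measurable_fst.
have mg : measurable_fun setT g.
  apply: (measurableT_comp mf); apply/measurable_fun_pairP.
  by split; apply: measurable_funD => //; apply: measurable_maxr => //;
    exact: measurable_funB.
have law C (D : set (Rm * Rm)) : measurable C -> measurable D ->
    Q (W @^-1` C `&` (fun t => (X t, Y t)) @^-1` D) =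
    k%:num%:E * (exponential_law ltr01 C * exponential_law2 a0 b0 D).
  move=> mC mD.
  have c0 : (0 <= k%:num * fine (exponential_prob 1 C))%R.
    by rewrite mulr_ge0// fine_ge0// e0.
  rewrite setIC.
  have kE : (NngNum c0)%:num%:E = k%:num%:E * exponential_prob 1 C.
    by rewrite /= EFinM fineK// exponential_prob_fin.
  have := @joint_law _ _ _ T Rm Rm R (mrestr Q (mW1 _ mC)) X Y mX mY
    (exponential_law a0) (exponential_law b0) (NngNum c0) _ D mD.
  have assoc (u x y z : \bar R) : u * (x * y * z) = u * z * (x * y).
    by rewrite -!muleA; congr (_ * _); rewrite muleA muleC.
  rewrite kE -muleA; apply => A' B' mA' mB'.
  exact: (eq_trans (lawXYW mA' mB' mC) (assoc _ _ _ _)).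
pose P2 := exponential_law2 a0 b0.
transitivity (\int[Q]_t g (W t, (X t, Y t))).
  transitivity (\int[Q]_t (\1_(((fun t => W t + Num.max 0 (X t - Y t))%R @^-1` A `&`
     (fun t => W t + Num.max 0 (Y t - X t))%R @^-1` B)) t)%:E).
    rewrite integral_indic ?setIT//.
    have m3 (U V : T -> R) : measurable_fun setT U -> measurable_fun setT V ->
        measurable_fun setT (fun t => W t + Num.max 0 (U t - V t))%R.
      move=> mU mV; apply: measurable_funD => //; apply: measurable_maxr => //.
      exact: measurable_funB.
    by apply: measurableI; rewrite -[X in measurable X]setTI; apply: m3.
  by apply: eq_integral => t _; rewrite /g /f !indicE; congr (_%:R%:E); apply/idP/idP;
    rewrite !inE.
have J := @ge0_integral_joint_law _ _ _ T Rm (Rm * Rm)%type R Q W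
  (fun t => (X t, Y t)) mW mXY
  (exponential_law ltr01) P2 k law g mg (fun q => f0 _).
apply: (eq_trans J); congr (_ * _).
apply: (eq_trans (exponential_law_burke a0 b0 ab1 mf f0)).
rewrite integral_indic// setIT.
exact: product_measure1E.
Qed.
End burke_flip.

(** * Lists of independent exponential variables *)

Section has_law.
Context d (T : measurableType d) (R : realType).
Local Open Scope ereal_scope.
Implicit Types (L : seq ((T -> R) * R)) (B : set T) (c : \bar R).

(** For every choice of one measurable set per entry (X, r) of L, the measure
    of B intersected with the events that X lies in its set is c times the
    product of the exponential probabilities of the sets. So for Q a
    probability, B the whole space and c = 1 the entries are independent
    exponentials of the listed rates. The event B and the mass c accumulate the
    conditions on entries already processed, which is what lets an induction on
    L reduce to the entries that a transformation touches. *)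
Fixpoint has_law (Q : set T -> \bar R) L B c : Prop :=
  match L with
  | [::] => Q B = c
  | (X, r) :: L' => [/\ (0 < r)%R, measurable_fun setT X &
      forall A : set R, measurable A ->
        has_law Q L' (B `&` X @^-1` A) (c * exponential_prob r A)]
  end.

Lemma has_law_swap Q x y L B c :
  has_law Q (x :: y :: L) B c -> has_law Q (y :: x :: L) B c.
Proof.
case: x y => [X r] [Y q] /= [r0 mX H].
have [q0 mY _] := H setT measurableT.
split; [exact: q0|exact: mY|move=> A mA].
split; [exact: r0|exact: mX|move=> A' mA'].
rewrite setIAC muleAC.
by have [_ _ K] := H A' mA'; exact: K.
Qed.

Lemma has_law_cons Q x L L' : (forall B c, has_law Q L B c -> has_law Q L' B c) ->
  forall B c, has_law Q (x :: L) B c -> has_law Q (x :: L') B c.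
Proof.
case: x => X r H B c /= [r0 mX K]; split; [exact: r0|exact: mX|].
by move=> A mA; apply: H; exact: K.
Qed.

Lemma has_law_cat_cons Q x L L' B c :
  has_law Q (L ++ x :: L') B c <-> has_law Q (x :: L ++ L') B c.
Proof.
elim: L B c => [//|y L IH] B c; rewrite !cat_cons; split.
  move=> H; apply: has_law_swap; move: H; apply: has_law_cons => B' c'.
  by rewrite IH.
move=> /has_law_swap; apply: has_law_cons => B' c'.
by rewrite IH.
Qed.

(** Stated with perm_eq so that reorderings are settled by counting
    occurrences. *)
Lemma has_law_perm Q L L' B c : perm_eq L L' ->
  has_law Q L B c -> has_law Q L' B c.
Proof.
elim: L L' B c => [|x L IH] L' B c.
  by rewrite perm_sym => /perm_nilP ->.
move=> pL; have xL' : x \in L' by rewrite -(perm_mem pL) mem_head.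
case/splitPr : xL' pL => L1 L2 pL H.
rewrite has_law_cat_cons; move: H; apply: has_law_cons => B' c'; apply: IH.
by rewrite -(perm_cons x) (permPl pL) perm_catC cat_cons perm_cons perm_catC.
Qed.

Lemma has_law_behead Q x L B c : has_law Q (x :: L) B c -> has_law Q L B c.
Proof.
case: x => X r /= [r0 _ /(_ setT measurableT)].
by rewrite preimage_setT setIT exponential_prob_setT// mule1.
Qed.


Lemma integral_setI_indic (Q : {measure set T -> \bar R}) B C (f : T -> R) :
  measurable B -> measurable C -> \int[Q]_(t in B `&` C) (f t)%:E =
  \int[Q]_t ((\1_C t * f t)%:E * (\1_B t)%:E).
Proof.
move=> mB mC; rewrite [LHS]integral_mkcond; apply: eq_integral => t _.
rewrite -EFinM patchE in_setI !indicE andbC.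
by do 2 case: (_ \in _); rewrite ?mul0r ?mulr1 ?mulr0 ?mul1r.
Qed.

(** Entries other than X ride along in the event B. For the remaining entry,
    the image under X of Q restricted to B is c times an exponential law, to
    which [exponential_law_tilt] applies. *)
Lemma has_law_tilt (Q : {measure set T -> \bar R}) (a : R) X r L B c :
  measurable B -> 0 <= c -> c \is a fin_num -> (a < r)%R ->
  has_law Q ((X, r) :: L) B c ->
  has_law (density_measure Q (fun t => expR (a * X t))) ((X, r - a)%R :: L) B
    ((r / (r - a))%:E * c).
Proof.
move=> + + + ar; elim: L B c => [|y L IH] B c mB c0 cfin.
  move=> /= [r0 mX H]; split; [by rewrite subr_gt0|exact: mX|].
  move=> A mA.
  have mXA : measurable (X @^-1` A) by rewrite -[X in measurable X]setTI; exact: mX.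
  have me : measurable_fun setT (fun x : R => expR (a * x)).
    by apply: measurableT_comp => //; exact: measurable_funM.
  have mi : measurable_fun setT (\1_B : T -> R) by [].
  have i0 t : (0 <= \1_B t :> R)%R by [].
  pose QB := weighted_measure Q mi i0.
  pose k : {nonneg R} := NngNum (fine_ge0 c0).
  have kE : k%:num%:E = c by rewrite /= fineK.
  have lawk (A' : set R) : measurable A' ->
      QB (X @^-1` A') = k%:num%:E * exponential_law r0 A'.
    move=> mA'; rewrite kE -[RHS](H _ mA') /QB.
    transitivity (\int[Q]_(t in X @^-1` A') (\1_B t)%:E); first by [].
    rewrite integral_indic//.
    by rewrite -[X in measurable X]setTI; exact: mX.
  pose f (x : R) : \bar R := (\1_A x * expR (a * x))%:E.
  have mf : measurable_fun setT f by apply/measurable_EFinP; exact: measurable_funM.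
  have f0 x : 0 <= f x by rewrite lee_fin mulr_ge0// expR_ge0.
  rewrite /density_measure integral_setI_indic//.
  rewrite -(@ge0_integral_density _ _ _ Q _ mi i0 (f \o X)); last 2 first.
  - exact: measurableT_comp.
  - by move=> t; exact: f0.
  have mX' : measurable_fun setT (X : T -> measurableTypeR R) by exact: mX.
  pose m' : {measure set (measurableTypeR R) -> \bar R} :=
    measure_function_pushforward__canonical__measure_function_Measure QB mX'.
  transitivity (\int[m']_x f x).
    have E := @ge0_integral_pushforward _ _ _ _ _ _ mX' QB setT f measurableT mf
      (fun y _ => f0 y).
    by rewrite preimage_setT in E; exact: (esym E).
  transitivity (\int[scaled_probability (exponential_law r0) k]_x f x).
    by apply: eq_measure_integral => A' mA' _; exact: lawk.
  rewrite ge0_integral_scaled_probability// kE [RHS]muleAC [RHS]muleC.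
  by congr (_ * _); exact: exponential_law_tilt.
case: y => Y q /has_law_swap/= [q0 mY H].
apply: (@has_law_swap _ (Y, q) (X, r - a)%R L).
split; [exact: q0|exact: mY|move=> A mA].
rewrite -muleA; apply: IH.
- by apply: measurableI => //; rewrite -[X in measurable X]setTI; exact: mY.
- by rewrite mule_ge0// exponential_prob_ge0.
- by rewrite fin_numM// exponential_prob_fin.
- exact: H.
Qed.

(** The inductive form of [burke_flip]: entries other than X, Y, W are moved to
    the front and absorbed into the event B. *)
Lemma has_law_flip (Q : {measure set T -> \bar R}) X Y W a b L B c :
  measurable B -> 0 <= c -> c \is a fin_num -> (a + b = 1)%R ->
  has_law Q [:: (X, a), (Y, b), (W, 1%R) & L] B c ->
  has_law Q [:: (fun t => W t + Num.max 0 (X t - Y t), a)%R,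
    (fun t => W t + Num.max 0 (Y t - X t), b)%R & L] B c.
Proof.
move=> + + + ab1; elim: L B c => [|y L IH] B c mB c0 cfin.
  move=> /= [a0 mX /(_ _ _)H].
  have [b0 mY _] := H setT measurableT.
  have [_ _ /(_ setT measurableT)[_ mW _]] := H setT measurableT.
  have m3 (U V : T -> R) : measurable_fun setT U -> measurable_fun setT V ->
      measurable_fun setT (fun t => W t + Num.max 0 (U t - V t))%R.
    move=> mU mV; apply: measurable_funD => //; apply: measurable_maxr => //.
    exact: measurable_funB.
  pose k : {nonneg R} := NngNum (fine_ge0 c0).
  have kE : k%:num%:E = c by rewrite /= fineK.
  split; [exact: a0|exact: m3|move=> A1 mA1].
  split; [exact: b0|exact: m3|move=> A2 mA2].
  rewrite -kE -muleA -setIA setIC.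
  have := @burke_flip _ _ _ (mrestr Q mB) X Y W a b k mX mY mW a0 b0 ab1 _ A1 A2 mA1 mA2.
  apply => A' B' C' mA' mB' mC'.
  have [_ _ /(_ _ mB')[_ _ /(_ _ mC') E]] := H _ mA'.
  have S : X @^-1` A' `&` Y @^-1` B' `&` W @^-1` C' `&` B =
      B `&` X @^-1` A' `&` Y @^-1` B' `&` W @^-1` C' by rewrite setIC !setIA.
  have assoc (u x y z : \bar R) : u * x * y * z = u * (x * y * z).
    by rewrite !muleA.
  rewrite kE; exact: (eq_trans (congr1 Q S) (eq_trans E (assoc _ _ _ _))).
case: y => Y' q H.
have : has_law Q [:: (Y', q), (X, a), (Y, b), (W, 1%R) & L] B c.
  by apply: has_law_perm H; apply/permP => p /=; lia.
move=> [q0 mY' H'].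
apply: (@has_law_perm Q ((Y', q) :: [:: (fun t => W t + Num.max 0 (X t - Y t), a)%R,
    (fun t => W t + Num.max 0 (Y t - X t), b)%R & L])).
  by apply/permP => p /=; lia.
split; [exact: q0|exact: mY'|move=> A mA]; apply: IH.
- by apply: measurableI => //; rewrite -[X in measurable X]setTI; exact: mY'.
- by rewrite mule_ge0// exponential_prob_ge0.
- by rewrite fin_numM// exponential_prob_fin.
- exact: H'.
Qed.

End has_law.

(** * The recursion for last-passage times, and their increments *)

Section lpp.
Context {R : realType}.
Implicit Types w : nat * nat -> R.

(** The last-passage time from the origin to (i, j), by its recursion. *)
Fixpoint lpp w (i j : nat) : R :=
  match i with
  | 0 => \sum_(l < j.+1) w (0, l : nat)%N
  | i'.+1 => (fix row j := match j with
      | 0 => lpp w i' 0%N + w (i'.+1, 0)%N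
      | j'.+1 => w (i'.+1, j'.+1)%N + Num.max (lpp w i' j'.+1) (row j')
      end) j
  end.

Lemma lpp00 w : lpp w 0 0 = w (0, 0)%N.
Proof. by rewrite /= big_ord1. Qed.

Lemma lpp0S w j : lpp w 0 j.+1 = lpp w 0 j + w (0, j.+1)%N.
Proof. by rewrite /= [LHS]big_ord_recr. Qed.

Lemma lppS0 w i : lpp w i.+1 0 = lpp w i 0 + w (i.+1, 0)%N.
Proof. by []. Qed.

Lemma lppSS w i j :
  lpp w i.+1 j.+1 = w (i.+1, j.+1)%N + Num.max (lpp w i j.+1) (lpp w i.+1 j).
Proof. by []. Qed.

Definition hor_inc w i j := lpp w i.+1 j - lpp w i j.
Definition ver_inc w i j := lpp w i j.+1 - lpp w i j.

Lemma hor_inc0 w i : hor_inc w i 0 = w (i.+1, 0)%N.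
Proof. by rewrite /hor_inc lppS0 addrC addKr. Qed.

Lemma ver_inc0 w j : ver_inc w 0 j = w (0, j.+1)%N.
Proof. by rewrite /ver_inc lpp0S addrC addKr. Qed.

Let max_shift (u x y z : R) :
  u + Num.max x y - x = u + Num.max 0 (y - z - (x - z)).
Proof.
have -> : y - z - (x - z) = y - x by ring.
rewrite -addrA; congr (_ + _).
by have [xy|yx] := leP x y; [rewrite max_r// subr_ge0|rewrite subrr max_l// subr_le0 ltW].
Qed.

(** This and [ver_incS] are the map of the Burke property, with X the
    horizontal increment below the vertex and Y the vertical one to its left.
    *)
Lemma hor_incS w i j : hor_inc w i j.+1 =
  w (i.+1, j.+1)%N + Num.max 0 (hor_inc w i j - ver_inc w i j).
Proof.
by rewrite /hor_inc /ver_inc lppSS; exact: max_shift.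
Qed.

Lemma ver_incS w i j : ver_inc w i.+1 j =
  w (i.+1, j.+1)%N + Num.max 0 (ver_inc w i j - hor_inc w i j).
Proof.
by rewrite /hor_inc /ver_inc lppSS maxC; exact: max_shift.
Qed.

Lemma lpp_hor w m n : lpp w m n = lpp w 0 n + \sum_(i <- iota 0 m) hor_inc w i n.
Proof.
elim: m => [|m IH]; first by rewrite big_nil addr0.
by rewrite -addn1 iotaD big_cat/= big_seq1 addrA -IH addn1 /hor_inc addrC subrK.
Qed.

Lemma lpp_ver w n : lpp w 0 n = w (0, 0)%N + \sum_(j <- iota 0 n) w (0, j.+1)%N.
Proof.
elim: n => [|n IH]; first by rewrite big_nil addr0 lpp00.
by rewrite lpp0S IH -[n.+1 in RHS]addn1 iotaD big_cat/= big_seq1 addrA add0n.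
Qed.

End lpp.
Arguments lpp : simpl never.

(** * Laws of the increments over a rectangle *)

Section laws.
Context d (T : measurableType d) (R : realType).
Local Open Scope ereal_scope.
Implicit Types (L : seq ((T -> R) * R)) (B : set T) (c : \bar R).

(** One flip per vertex, from left to right. The horizontal increment X k below
    the row is replaced by X' k above it, and the vertical increment V k is
    passed on to the next vertex as V (k + 1). *)
Lemma has_law_row (Q : {measure set T -> \bar R}) (X V W X' : nat -> T -> R) (a b : R) B c :
  measurable B -> 0 <= c -> c \is a fin_num -> (a + b = 1)%R ->
  (forall k, X' k = fun t => W k t + Num.max 0 (X k t - V k t))%R ->
  (forall k, V k.+1 = fun t => W k t + Num.max 0 (V k t - X k t))%R ->
  forall m k L,
  has_law Q ([seq (X i, a) | i <- iota k m] ++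
     (V k, b) :: [seq (W i, 1%R) | i <- iota k m] ++ L) B c ->
  has_law Q ([seq (X' i, a) | i <- iota k m] ++ (V (k + m)%N, b) :: L) B c.
Proof.
move=> mB c0 cfin ab1 EX EV; elim=> [|m IH] k L; first by rewrite addn0.
move=> H; rewrite addnS -addSn.
apply: (@has_law_perm _ _ _ _ ([seq (X' i, a) | i <- iota k.+1 m] ++
  (V (k.+1 + m)%N, b) :: (X' k, a) :: L)).
  by apply/permP => p /=; rewrite !count_cat/=; lia.
apply: IH.
apply: (@has_law_perm _ _ _ _ [:: (X' k, a), (V k.+1, b) &
  [seq (X i, a) | i <- iota k.+1 m] ++ [seq (W i, 1%R) | i <- iota k.+1 m] ++ L]).
  by apply/permP => p /=; rewrite !count_cat/= !count_cat/=; lia.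
rewrite EX EV; apply: has_law_flip => //.
by apply: has_law_perm H; apply/permP => p /=; rewrite !count_cat/= !count_cat/=; lia.
Qed.

(** From the weights of a rectangle with stationary boundary to the increments
    along its top row. The list holds, row by row, the y-axis weight followed
    by the bulk weights; each row costs one use of [has_law_row], after which
    the vertical increment that leaves the row on the right is discarded. *)
Lemma has_law_rectangle (Q : {measure set T -> \bar R}) (w : nat * nat -> T -> R)
    (a b : R) B c m n :
  measurable B -> 0 <= c -> c \is a fin_num -> (a + b = 1)%R ->
  has_law Q ([seq (w (i.+1, 0)%N, a) | i <- iota 0 m] ++
     flatten [seq (w (0, j.+1)%N, b) :: [seq (w (i.+1, j.+1)%N, 1%R) | i <- iota 0 m]
             | j <- iota 0 n]) B c ->
  has_law Q [seq (fun t => hor_inc (w ^~ t) i n, a) | i <- iota 0 m] B c.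
Proof.
move=> mB c0 cfin ab1.
pose H j := [seq (fun t => hor_inc (w ^~ t) i j, a) | i <- iota 0 m].
pose D j n := flatten [seq (w (0, j.+1)%N, b) ::
  [seq (w (i.+1, j.+1)%N, 1%R) | i <- iota 0 m] | j <- iota j n].
suff K k j : has_law Q (H j ++ D j k) B c -> has_law Q (H (j + k)%N) B c.
  move=> L; apply: (K n 0%N); rewrite /H.
  by under eq_map => i do under eq_fun do rewrite hor_inc0.
elim: k j => [|k IH] j; first by rewrite addn0 cats0.
move=> L; rewrite -addSnnS; apply: IH.
apply: (@has_law_behead _ _ _ _ (fun t => ver_inc (w ^~ t) m j, b)).
rewrite -has_law_cat_cons.
pose X i := fun t => hor_inc (w ^~ t) i j.
pose X' i := fun t => hor_inc (w ^~ t) i j.+1.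
pose V i := fun t => ver_inc (w ^~ t) i j.
pose W i := w (i.+1, j.+1)%N.
have V0 : V 0%N = w (0, j.+1)%N by apply/funext => t; rewrite /V ver_inc0.
apply: (@has_law_row Q X V W X' a b B c mB c0 cfin ab1 _ _ m 0%N).
- by move=> i; apply/funext => t; rewrite /X' hor_incS.
- by move=> i; apply/funext => t; rewrite /V ver_incS.
- by rewrite V0.
Qed.

(** Exponential tilting of all entries indexed by s, one after the other;
    entries of L and those with a k = 0 keep their law. Integrating f = 1
    against the new measure computes exponential moments of sums. *)
Lemma has_law_tilt_seq (K : Type) (X : K -> T -> R) (r a : K -> R) B :
  measurable B -> (forall k, (a k < r k)%R) ->
  forall (s : seq K) (Q : {measure set T -> \bar R}) L c, 0 <= c -> c \is a fin_num ->
  has_law Q ([seq (X k, r k) | k <- s] ++ L) B c ->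
  exists Q' : {measure set T -> \bar R},
    has_law Q' ([seq (X k, r k - a k)%R | k <- s] ++ L) B
      ((\prod_(k <- s) (r k / (r k - a k)))%:E * c) /\
    forall f : T -> \bar R, measurable_fun setT f -> (forall t, 0 <= f t) ->
      \int[Q']_t f t = \int[Q]_t (f t * (expR (\sum_(k <- s) a k * X k t))%:E).
Proof.
move=> mB ar; elim=> [|k s IH] Q L c c0 cfin H.
  exists Q; rewrite big_nil mul1e; split=> // f mf f0.
  by apply: eq_integral => t _; rewrite big_nil expR0 mule1.
have [r0 mX _] := H.
have mh : measurable_fun setT (fun t => expR (a k * X k t)).
  by apply: measurableT_comp => //; exact: measurable_funM.
pose Q1 := weighted_measure Q mh (fun t => expR_ge0 _).
have rk : (0 < r k / (r k - a k))%R by rewrite divr_gt0 ?subr_gt0.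
have c10 : 0 <= (r k / (r k - a k))%:E * c by rewrite mule_ge0// lee_fin ltW.
have c1fin : (r k / (r k - a k))%:E * c \is a fin_num by rewrite fin_numM.
have [] := IH Q1 ((X k, r k - a k)%R :: L) _ c10 c1fin.
  apply: (@has_law_perm _ _ _ _ ((X k, r k - a k)%R :: ([seq (X k, r k) | k <- s] ++ L))).
    by apply/permP => p /=; rewrite !count_cat/=; lia.
  exact: (has_law_tilt mB c0 cfin (ar k) H).
move=> Q' [H' E]; exists Q'; split.
  rewrite big_cons mulrC EFinM -muleA.
  apply: has_law_perm H'.
  by apply/permP => p /=; rewrite !count_cat/=; lia.
move=> f mf f0; rewrite (E f mf f0).
have ms : measurable_fun setT (fun t => (expR (\sum_(j <- s) a j * X j t))%:E).
  apply/measurable_EFinP; apply: measurableT_comp => //.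
  have: forall L' Q c, has_law Q ([seq (X k, r k) | k <- s] ++ L') B c ->
      measurable_fun setT (fun t => \sum_(j <- s) a j * X j t)%R.
    elim: (s) => [|j s' IHs] L' Q0 c' H0.
      under eq_fun do rewrite big_nil. exact: measurable_cst.
    under eq_fun do rewrite big_cons.
    have [_ mXj _] := H0; apply: measurable_funD; first exact: measurable_funM.
    exact: (IHs L' Q0 c' (has_law_behead H0)).
  by apply; exact: (has_law_behead H).
rewrite (ge0_integral_density Q mh (fun t => expR_ge0 _)); last 2 first.
- exact: emeasurable_funM.
- by move=> t; rewrite mule_ge0// lee_fin expR_ge0.
apply: eq_integral => t _; rewrite -muleA -EFinM -expRD big_cons addrC//.
Qed.

End laws.

(** * The exponential moment of the last-passage time *)

Section initial.
Context d (T : measurableType d) (R : realType) (P : probability T R).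
Local Open Scope ereal_scope.

Lemma has_law_mass (Q : set T -> \bar R) L B c : has_law Q L B c -> Q B = c.
Proof. by elim: L => // x L IH /has_law_behead. Qed.

Lemma has_law_iid (I : eqType) (eta : I -> {RV P >-> R}) (r : I -> R) (s : seq I) :
  iid_exponential 1 eta -> (forall i, (0 < r i)%R) -> uniq s ->
  has_law P [seq (fun t => eta i t / r i, r i)%R | i <- s] setT 1.
Proof.
move=> [ind expo] r0 us.
pose F (s0 : seq I) (A : I -> set R) := \bigcap_(i in [set` s0]) eta i @^-1` A i.
(* the indices s0 have been given their sets and moved into the event *)
have K : forall s0 A, (forall i, measurable (A i)) -> uniq (s0 ++ s) ->
    has_law P [seq (fun t => eta i t / r i, r i)%R | i <- s] (F s0 A)
      (\prod_(i <- s0) P (eta i @^-1` A i)).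
  elim: (s) => [|x s' IH] s0 A mA /=; first by rewrite cats0 => u0; exact: ind.
  move=> us0; have mX : measurable_fun setT (fun t => eta x t / r x)%R.
    by apply: measurable_funM.
  split; [exact: r0|exact: mX|move=> C mC].
  pose Cx : set R := (fun y => y / r x)%R @^-1` C.
  have mCx : measurable Cx.
    rewrite -[X in measurable X]setTI.
    have mdiv : measurable_fun setT (fun y : R => y / r x)%R by exact: measurable_funM.
    exact: mdiv.
  pose A' i := if i == x then Cx else A i.
  have xs0 : x \notin s0.
    by apply/negP => xs0; move: us0; rewrite cat_uniq /= xs0 /= andbF.
  have FE : F s0 A `&` (fun t => eta x t / r x)%R @^-1` C = F (rcons s0 x) A'.
    apply/seteqP; split => t /=.
      move=> [Ft Ct] i /=; rewrite mem_rcons inE /A'.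
      have [->//|_ /= is0] := eqVneq i x; exact: Ft.
    move=> Ft; split.
      move=> i /= is0; have := Ft i; rewrite /= mem_rcons inE is0 orbT /A' => /(_ isT).
      by case: eqP => // ix; move: xs0; rewrite -ix is0.
    by have := Ft x; rewrite /= mem_rcons mem_head /A' eqxx => /(_ isT).
  have PE : \prod_(i <- s0) P (eta i @^-1` A i) * exponential_prob (r x) C =
      \prod_(i <- rcons s0 x) P (eta i @^-1` A' i).
    rewrite -cats1 big_cat/= big_seq1; congr (_ * _).
      apply: eq_big_seq => i is0; rewrite /A'; case: eqP => // ix.
      by move: xs0; rewrite -ix is0.
    rewrite /A' eqxx -exponential_prob_scale//; symmetry; exact: expo.
  rewrite FE PE; apply: IH.
    by move=> i; rewrite /A'; case: eqP.
  by rewrite cat_rcons.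
have := K [::] (fun=> setT) (fun=> measurableT) us.
rewrite /F big_nil (_ : \bigcap_(i in _) _ = setT)//.
by apply/seteqP; split => // t _ i.
Qed.

End initial.

Section mgf.
Context {R : realType}.

Definition boundary_rate (w z : R) (x : nat * nat) : R :=
  match x with
  | (_.+1, 0%N) => w
  | (0%N, _.+1) => 1 - z
  | _ => 1
  end.

(** Boundary weights with x-axis rate w and y-axis rate 1 - z. Every vertex but
    the origin is written as a quotient by its rate, the bulk having rate 1. *)
Definition two_rate_weight (eta : nat * nat -> R) (w z : R) (x : nat * nat) : R :=
  if x == (0, 0)%N then 0 else eta x / boundary_rate w z x.

Lemma boundary_weightE eta z : boundary_weight eta z = two_rate_weight eta z z.
Proof.
by apply/funext => -[[|i] [|j]]; rewrite /two_rate_weight //= divr1.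
Qed.

Lemma measurable_lpp d (T : measurableType d) (w : T -> nat * nat -> R) :
  (forall x, measurable_fun setT (fun t => w t x)) ->
  forall i j, measurable_fun setT (fun t => lpp (w t) i j).
Proof.
move=> mw; elim=> [|i IHi] j.
  elim: j => [|j IHj]; first under eq_fun do rewrite lpp00.
    exact: mw.
  under eq_fun do rewrite lpp0S; exact: measurable_funD.
elim: j => [|j IHj]; first by under eq_fun do rewrite lppS0; apply: measurable_funD.
under eq_fun do rewrite lppSS; apply: measurable_funD => //.
exact: measurable_maxr.
Qed.

Section iid.
Context d (T : measurableType d) (P : probability T R)
  (eta : nat * nat -> {RV P >-> R}).
Hypothesis iid : iid_exponential 1 eta.

Lemma measurable_two_rate_weight w z x :
  measurable_fun setT (fun t => two_rate_weight (fun y => eta y t) w z x).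
Proof.
rewrite /two_rate_weight; case: eqP => _; first exact: measurable_cst.
exact: measurable_funM.
Qed.

(** Two tiltings. The first gives the y-axis the rate 1 - z - (w - z) = 1 - w,
    so that the boundary becomes stationary with parameter w; the second
    computes the exponential moment of the top row, whose increments have rate
    w by [has_law_rectangle]. *)
Lemma lpp_mgf (w z : R) m n : 0 < w -> w < 1 -> 0 < z -> z < 1 ->
  (\int[P]_t (expR ((w - z) * lpp (two_rate_weight (fun x => eta x t) w z) m n))%:E =
  ((w / z) ^+ m * ((1 - z) / (1 - w)) ^+ n)%:E)%E.
Proof.
move=> w0 w1 z0 z1.
pose r := boundary_rate w z.
pose a (x : nat * nat) : R := if (x.1 == 0%N) && (0 < x.2)%N then w - z else 0.
pose W (x : nat * nat) (t : T) := two_rate_weight (fun y => eta y t) w z x.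
pose X (x : nat * nat) (t : T) := eta x t / r x.
pose s : seq (nat * nat) := [seq (i.+1, 0)%N | i <- iota 0 m] ++
  flatten [seq (0, j.+1)%N :: [seq (i.+1, j.+1) | i <- iota 0 m] | j <- iota 0 n].
have r0 x : 0 < r x.
  by rewrite /r; move: x => [[|i] [|j]]//=; rewrite subr_gt0.
have ar x : a x < r x.
  rewrite /a; case: ifPn => [|_]; last exact: r0.
  by move: x => [[|i] [|j]]//= _; rewrite /r/= ltrD2r.
have us : uniq s.
  rewrite cat_uniq; apply/and3P; split.
  - by rewrite map_inj_uniq ?iota_uniq// => i j [].
  - apply/hasPn => x /flatten_mapP[j _]; rewrite inE => /orP[/eqP->|/mapP[i _ ->]];
    by apply/negP => /mapP[? _].
  - rewrite (_ : flatten _ = [seq (i, j.+1) | j <- iota 0 n, i <- iota 0 m.+1]).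
      apply: allpairs_uniq; rewrite ?iota_uniq//.
      by move=> [i j] [i' j'] _ _ /= [-> ->].
    congr flatten; apply: eq_map => j /=; congr cons.
    by rewrite -[1%N]addn0 iotaDl -map_comp.
have L0 : has_law P ([seq (X x, r x) | x <- s] ++ [::]) setT 1%E.
  rewrite cats0; exact: has_law_iid.
have [Q' [L1 E1]] := has_law_tilt_seq measurableT ar lee01 (isT : 1%E \is a fin_num) L0.
set c1 := (_ * 1)%E in L1.
have c1E : c1 = (((1 - z) / (1 - w)) ^+ n)%:E.
  rewrite /c1 mule1; congr EFin; rewrite big_cat/= big_map big1 ?mul1r; last first.
    by move=> i _; rewrite /a/= subr0 divff// gt_eqF.
  rewrite big_flatten/= big_map.
  under eq_bigr => j _.
    rewrite big_cons /a /= big_map big1 ?mulr1; last first.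
      by move=> i _; rewrite subr0 /r/= divr1.
    rewrite (_ : 1 - z - (w - z) = 1 - w); last by ring.
    over.
  by rewrite big_const_seq count_predT size_iota iter_mulr_1.
have c10 : (0 <= c1)%E.
  by rewrite c1E lee_fin exprn_ge0// divr_ge0// subr_ge0 ltW.
have c1fin : c1 \is a fin_num by rewrite c1E.
have WX x : x != (0, 0)%N -> W x = X x.
  by move=> x0; apply/funext => t; rewrite /W /two_rate_weight (negbTE x0).
have L2 : has_law Q' ([seq (W (i.+1, 0)%N, w) | i <- iota 0 m] ++
     flatten [seq (W (0, j.+1)%N, 1 - w) :: [seq (W (i.+1, j.+1)%N, 1%R) | i <- iota 0 m]
             | j <- iota 0 n]) setT c1.
  move: L1; rewrite cats0 map_cat map_flatten -!map_comp.
  rewrite (eq_map (g := fun i => (W (i.+1, 0)%N, w))); last first.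
    by move=> i /=; rewrite WX// /a/= subr0.
  rewrite [X in _ ++ flatten X](eq_map (g := fun j =>
     (W (0, j.+1)%N, 1 - w) :: [seq (W (i.+1, j.+1)%N, 1%R) | i <- iota 0 m]))//.
  move=> j /=; rewrite -map_comp WX// /a/=; congr ((_, _) :: _); first by ring.
  by apply: eq_map => i /=; rewrite WX// subr0.
have w1E : w + (1 - w) = 1 by ring.
have L3 := has_law_rectangle measurableT c10 c1fin w1E L2.
have ar' (i : nat) : w - z < w by rewrite ltrBlDr ltrDl.
rewrite -[map _ _]cats0 in L3.
have [Q2 [L4 E2]] := has_law_tilt_seq measurableT ar' c10 c1fin L3.
have M := has_law_mass L4.
have mW x : measurable_fun setT (W x) by exact: measurable_two_rate_weight.
have mlpp := measurable_lpp (w := fun t x => W x t) mW.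
have msum (I : Type) (l : seq I) (f : I -> T -> R) :
    (forall i, measurable_fun setT (f i)) ->
    measurable_fun setT (fun t => \sum_(i <- l) (w - z) * f i t).
  move=> mf; elim: l => [|i l IH].
    by under eq_fun do rewrite big_nil; exact: measurable_cst.
  by under eq_fun do rewrite big_cons; apply: measurable_funD => //; exact: measurable_funM.
have := E2 (cst 1%E) (measurable_cst _) (fun=> lee01).
rewrite integral_cst// mul1e M => M'.
pose f t : \bar R := (1 * (expR (\sum_(k <- iota 0 m) (w - z) *
  hor_inc (fun x => W x t) k n))%:E)%E.
have mf : measurable_fun setT f.
  rewrite /f; under eq_fun do rewrite mul1e; apply/measurable_EFinP.
  apply: measurableT_comp => //; apply: msum => i.
  by apply: measurable_funB; exact: mlpp.
have f0 t : (0 <= f t)%E by rewrite /f mul1e lee_fin expR_ge0.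
transitivity ((\prod_(k <- iota 0 m) (w / (w - (w - z))))%:E * c1)%E; last first.
  rewrite c1E -EFinM; congr (_ * _)%:E.
  by rewrite big_const_seq count_predT size_iota iter_mulr_1 opprB addrC subrK.
have sE t : \sum_(k <- s) a k * X k t =
    \sum_(j <- iota 0 n) (w - z) * X (0, j.+1)%N t.
  rewrite big_cat/= big_map big1 ?add0r; last by move=> i _; rewrite /a/= mul0r.
  rewrite big_flatten/= big_map; apply: eq_bigr => j _.
  rewrite big_cons big_map big1 ?addr0; last by move=> i _; rewrite /a/= mul0r.
  by rewrite /a.
rewrite M' -/(f _) (E1 f mf f0); apply: eq_integral => t _.
rewrite /f mul1e -EFinM -expRD; congr (expR _)%:E.
rewrite -mulr_sumr lpp_hor lpp_ver mulrDr [LHS]addrC; congr (_ + _).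
rewrite [two_rate_weight _ _ _ (0, 0)%N]/two_rate_weight/= add0r.
by rewrite mulr_sumr sE; apply: eq_bigr => j _; rewrite -WX.
Qed.

End iid.
End mgf.

(** * Paths, exit points and the comparison of parameters *)

Section paths.
Context {R : realType}.
Implicit Types (w eta : nat * nat -> R) (u v : nat * nat) (p q : seq (nat * nat)).

Definition path_weight w p : R := \sum_(x <- p) w x.

Lemma path_weight_le_lpp w s : path up_right_step (0, 0)%N s ->
  path_weight w ((0, 0)%N :: s) <=
  lpp w (last (0, 0)%N s).1 (last (0, 0)%N s).2.
Proof.
elim/last_ind: s => [_|s x IH].
  by rewrite /path_weight big_seq1 lpp00.
rewrite rcons_path last_rcons => /andP[ps st].
rewrite /path_weight -rcons_cons -cats1 big_cat big_seq1/=.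
have := IH ps; rewrite -/(path_weight _ _).
move: st; case: (last (0, 0)%N s) => i j; rewrite /up_right_step /=.
case/orP => /eqP -> /= le_ij.
  case: j le_ij => [|j] le_ij; first by rewrite [leRHS]lppS0 lerD2r.
  by rewrite [leRHS]lppSS addrC lerD2l (le_trans le_ij)// le_max lexx.
case: i le_ij => [|i] le_ij; first by rewrite [leRHS]lpp0S lerD2r.
by rewrite [leRHS]lppSS addrC lerD2l (le_trans le_ij)// le_max lexx orbT.
Qed.

Lemma lpp_path w i j : exists2 p, up_right_paths (0, 0)%N (i, j) p &
  path_weight w p = lpp w i j.
Proof.
have ext u v p : up_right_paths (0, 0)%N u p -> up_right_step u v ->
    up_right_paths (0, 0)%N v (rcons p v) /\
    path_weight w (rcons p v) = path_weight w p + w v.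
  move=> [s [-> ps lsu]] st; split.
    by exists (rcons s v); rewrite rcons_path last_rcons ps lsu st.
  by rewrite /path_weight -cats1 big_cat big_seq1.
have stR a b : up_right_step (a, b) (a.+1, b) by rewrite /up_right_step eqxx.
have stU a b : up_right_step (a, b) (a, b.+1) by rewrite /up_right_step eqxx orbT.
elim: i j => [|i IHi] j.
  elim: j => [|j [p Pp pE]].
    exists [:: (0, 0)%N]; last by rewrite /path_weight big_seq1 lpp00.
    by exists [::].
  have [Pp' E] := ext _ _ _ Pp (stU 0%N j).
  by exists (rcons p (0, j.+1)%N) => //; rewrite E pE lpp0S.
elim: j => [|j [p Pp pE]].
  have [p Pp pE] := IHi 0%N; have [Pp' E] := ext _ _ _ Pp (stR i 0%N).
  by exists (rcons p (i.+1, 0)%N) => //; rewrite E pE lppS0.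
rewrite lppSS; case: (leP (lpp w i j.+1)) => _.
  have [Pp' E] := ext _ _ _ Pp (stU i.+1 j).
  by exists (rcons p (i.+1, j.+1)) => //; rewrite E pE addrC.
have [p' Pp' pE'] := IHi j.+1; have [Pp'' E] := ext _ _ _ Pp' (stR i j.+1).
by exists (rcons p' (i.+1, j.+1)) => //; rewrite E pE' addrC.
Qed.

Lemma path_weight_lpp w i j p : up_right_paths (0, 0)%N (i, j) p ->
  path_weight w p <= lpp w i j.
Proof.
by move=> [s [-> ps lsE]]; have := path_weight_le_lpp w ps; rewrite lsE.
Qed.

Lemma last_passageE w i j : last_passage w (0, 0)%N (i, j) = (lpp w i j)%:E.
Proof.
apply/eqP; rewrite eq_le; apply/andP; split.
  apply: ge_ereal_sup => _ [p Pp <-]; rewrite lee_fin; exact: path_weight_lpp.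
have [p Pp <-] := lpp_path w i j.
by apply: ereal_sup_ubound; exists p.
Qed.

Lemma up_right_paths_ge u v p x : up_right_paths u v p -> x \in p ->
  (u.1 <= x.1)%N /\ (u.2 <= x.2)%N.
Proof.
move=> [s [-> ps _]]; rewrite inE => /orP[/eqP-> //|].
elim: s u ps => // y s IH u /= /andP[st ps]; rewrite inE => xs.
have [uy1 uy2] : (u.1 <= y.1)%N /\ (u.2 <= y.2)%N.
  by case/orP: st => /eqP->.
case/orP: xs => [/eqP-> //|xs].
have [yx1 yx2] := IH y ps xs.
by split; [exact: leq_trans yx1|exact: leq_trans yx2].
Qed.

(** Cut the path at the last point h of the x-axis that it visits. *)
Lemma path_hor_split a m n p : (0 < n)%N -> up_right_paths (a, 0)%N (m, n) p ->
  exists h q, [/\ (a <= h)%N, up_right_paths (h, 1)%N (m, n) q &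
    forall w, path_weight w p = \sum_(a <= l < h.+1) w (l, 0)%N + path_weight w q].
Proof.
move=> n0 [s [-> {p}]]; elim: s a => [|x s IH] a /=.
  by move=> _ [_ n0']; rewrite -n0' in n0.
move=> /andP[/orP[]/eqP-> ps] lsE.
  have [h [q [ah Pq E]]] := IH _ ps lsE; exists h, q; split => //.
    exact: ltnW.
  move=> w; rewrite /path_weight big_cons/= -/(path_weight w _) E big_ltn ?addrA//.
  by rewrite ltnS ltnW.
exists a, ((a, 1)%N :: s); split => //; first by exists s.
by move=> w; rewrite /path_weight big_cons big_nat1.
Qed.

Lemma path_hor_join w a h m n q : (a <= h)%N -> up_right_paths (h, 1)%N (m, n) q ->
  exists2 p, up_right_paths (a, 0)%N (m, n) p &
    path_weight w p = \sum_(a <= l < h.+1) w (l, 0)%N + path_weight w q.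
Proof.
move=> ah Pq; have [k kE] : exists k, h = (a + k)%N by exists (h - a)%N; rewrite subnKC.
elim: k a {ah} kE => [|k IH] a kE.
  rewrite addn0 in kE; rewrite -kE; case: Pq => s [-> ps lsE].
  exists ((h, 0)%N :: (h, 1)%N :: s); last by rewrite {1}/path_weight big_cons big_nat1.
  by exists ((h, 1)%N :: s); split=> //=; rewrite ps /up_right_step eqxx orbT.
have [|p [s [-> ps lsE]] E] := IH a.+1; first by rewrite addSnnS.
exists ((a, 0)%N :: (a.+1, 0)%N :: s).
  by exists ((a.+1, 0)%N :: s); split=> //=; rewrite ps /up_right_step eqxx.
rewrite {1}/path_weight big_cons/= -/(path_weight w _) E addrA -big_ltn//.
by rewrite kE ltnS leq_addr.
Qed.

Definition swap_pair (x : nat * nat) : nat * nat := (x.2, x.1).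

Lemma swap_pairK : involutive swap_pair. Proof. by case. Qed.

Lemma up_right_paths_swap u v p : up_right_paths u v p ->
  up_right_paths (swap_pair u) (swap_pair v) [seq swap_pair x | x <- p].
Proof.
move=> [s [-> ps <-]]; exists [seq swap_pair x | x <- s]; split => //.
  rewrite path_map; apply: sub_path ps => x y; rewrite /up_right_step /=.
  by case/orP => /eqP ->; rewrite eqxx ?orbT.
by rewrite last_map.
Qed.

Lemma path_weight_swap w p :
  path_weight w [seq swap_pair x | x <- p] = path_weight (w \o swap_pair) p.
Proof. by rewrite /path_weight big_map. Qed.

Lemma last_passage_swap w u v :
  last_passage (w \o swap_pair) u v = last_passage w (swap_pair u) (swap_pair v).
Proof.
rewrite /last_passage; congr ereal_sup; apply/seteqP; split => _ [p Pp <-].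
  exists [seq swap_pair x | x <- p]; first exact: up_right_paths_swap.
  by congr EFin; exact: path_weight_swap.
exists [seq swap_pair x | x <- p].
  by rewrite -(swap_pairK u) -(swap_pairK v); exact: up_right_paths_swap.
congr EFin; rewrite [LHS]big_map; apply: eq_bigr => x _.
by rewrite /= swap_pairK.
Qed.

Lemma exit_ver_swap eta (z : R) m n :
  exit_ver eta z m n = exit_hor (eta \o swap_pair) (1 - z) n m.
Proof.
have E : boundary_weight (eta \o swap_pair) (1 - z) = boundary_weight eta z \o swap_pair.
  by apply/funext => -[[|i] [|j]] //=; rewrite opprB addrC subrK.
by rewrite /exit_ver /exit_hor; apply: eq_bigl => l; rewrite /Ghat E !last_passage_swap.
Qed.


Definition axis_sum eta h : R := \sum_(1 <= l < h.+1) eta (l, 0)%N.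

Lemma two_rate_weight_hor eta (w z : R) h :
  \sum_(1 <= l < h.+1) two_rate_weight eta w z (l, 0)%N = axis_sum eta h / w.
Proof.
rewrite /axis_sum mulr_suml; apply: eq_big_nat => l /andP[l0 _].
by case: l l0.
Qed.

Lemma two_rate_weight_bulk eta (w z : R) u v q : (0 < u.1)%N -> (0 < u.2)%N ->
  up_right_paths u v q -> path_weight (two_rate_weight eta w z) q = path_weight eta q.
Proof.
move=> u1 u2 Pq; apply: eq_big_seq => x xq.
have [] := up_right_paths_ge Pq xq; case: x {xq} => [[|i] [|j]] /=.
- by rewrite leqNgt u1.
- by rewrite leqNgt u1.
- by move=> _; rewrite leqNgt u2.
- by move=> _ _; rewrite /two_rate_weight /= divr1.
Qed.

(** The first step decides: a path that starts upwards never meets the x-axis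
    again, so its weight does not depend on w. *)
Lemma two_rate_path_split eta m n p : (0 < n)%N ->
  up_right_paths (0, 0)%N (m, n) p ->
  (exists h q, [/\ (0 < h)%N, up_right_paths (h, 1)%N (m, n) q &
    forall w z : R, path_weight (two_rate_weight eta w z) p =
      axis_sum eta h / w + path_weight eta q]) \/
  (forall w w' z : R, path_weight (two_rate_weight eta w z) p =
    path_weight (two_rate_weight eta w' z) p).
Proof.
move=> n0 [[|x s] [-> /=]]; first by move=> _ [_ n0']; rewrite -n0' in n0.
move=> /andP[/orP[]/eqP-> ps] lsE; [left|right] => /=.
  have [|h [q [h1 Pq E]]] := @path_hor_split 1 m n ((1, 0)%N :: s) n0.
    by exists s.
  exists h, q; split => // w z.
  rewrite {1}/path_weight big_cons -/(path_weight _ _) E two_rate_weight_hor.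
  rewrite (two_rate_weight_bulk _ _ _ _ _ Pq)//.
  by rewrite /two_rate_weight/= add0r.
move=> w w' z; apply: eq_big_seq => y; rewrite inE => /orP[/eqP->//|ys].
have [|_] := @up_right_paths_ge (0, 1)%N (m, n) ((0, 1)%N :: s) y _ ys.
  by exists s.
by case: y {ys} => [[|i] [|j]].
Qed.

Lemma lpp_ge_exit eta (w z : R) m n h q : (0 < h)%N ->
  up_right_paths (h, 1)%N (m, n) q ->
  axis_sum eta h / w + path_weight eta q <= lpp (two_rate_weight eta w z) m n.
Proof.
move=> h0 Pq; have [p Pp E] := path_hor_join (two_rate_weight eta w z) (leq0n h) Pq.
apply: le_trans (path_weight_lpp _ Pp).
rewrite E (two_rate_weight_bulk _ _ _ _ _ Pq)// lerD2r big_ltn//.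
by rewrite two_rate_weight_hor {1}/two_rate_weight/= add0r.
Qed.

Lemma exit_horP eta (z : R) m n k : (0 < k)%N -> (k <= exit_hor eta z m n)%N ->
  exists2 i, (k <= i)%N & exists2 q, up_right_paths (i, 1)%N (m, n) q &
    lpp (two_rate_weight eta z z) m n = axis_sum eta i / z + path_weight eta q.
Proof.
move=> k0; rewrite /exit_hor => kle.
have [i ki iE] : exists2 i, (k <= i)%N &
   Ghat eta z (0, 0)%N (m, n)%N ==
     (Ghat eta z (0, 0)%N (i, 0)%N + Ghat eta z (i, 1)%N (m, n)%N)%E.
  move: kle; elim/big_ind : _ => [|x y IHx IHy|i iE ki].
  - by rewrite leqn0 => /eqP k0'; rewrite k0' in k0.
  - by rewrite leq_max => /orP[].
  - by exists i.
exists i => //; move: iE; rewrite /Ghat boundary_weightE !last_passageE.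
have [E0|] := eqVneq (up_right_paths (i, 1)%N (m, n)) set0.
  by rewrite /last_passage E0 image_set0 ereal_sup0.
move=> /set0P ne.
have [q Pq ->] := last_passage_attained (two_rate_weight eta z z) ne.
move=> /eqP[E]; exists q => //.
have i0 : (0 < i)%N by exact: leq_trans ki.
rewrite E -/(path_weight _ _) (two_rate_weight_bulk _ _ _ _ _ Pq)//; congr (_ + _).
rewrite -(two_rate_weight_hor _ _ z).
elim: (i) => [|i' IH]; first by rewrite big_geq// lpp00.
by rewrite lppS0 IH [RHS]big_nat_recr.
Qed.

(** Let i >= k be an exit point of the optimal path for the rates (z, 1 - z),
    and p an optimal path for (w, z). If p leaves the x-axis at h > i, changing
    w to u along p already gains (1/u - 1/w) S_h >= (1/u - 1/w) S_k. Otherwise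
    p has at most the weight of the path through i: this holds for the rate z
    by optimality, and changing z to w gains (1/w - 1/z) S_i for the latter
    against at most (1/w - 1/z) S_i for p; now change w to u along the path
    through i. Either way the path obtained starts along the x-axis, so its
    weight does not involve v. *)
Lemma exit_hor_comparison eta (u w z v : R) m n k : (0 < n)%N -> (0 < k)%N ->
  0 < u -> u <= w -> w <= z -> (forall l, (l <= m)%N -> 0 <= eta (l, 0)%N) ->
  (k <= exit_hor eta z m n)%N ->
  lpp (two_rate_weight eta w z) m n + (u^-1 - w^-1) * axis_sum eta k <=
  lpp (two_rate_weight eta u v) m n.
Proof.
move=> n0 k0 u0 uw wz eta0 kex.
have [i ki [qi Pqi Ei]] := exit_horP k0 kex.
have im : (i <= m)%N by case: Pqi => s [_ /up_right_path_le[+ _] lsE]; rewrite lsE.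
have i0 : (0 < i)%N by exact: leq_trans ki.
have w0 : 0 < w by exact: lt_le_trans uw.
have z0 : 0 < z by exact: lt_le_trans wz.
have Sle h h' : (h <= h')%N -> (h' <= m)%N -> axis_sum eta h <= axis_sum eta h'.
  move=> hh' h'm; rewrite /axis_sum (@big_cat_nat _ _ _ h.+1 1 h'.+1)//=.
  rewrite lerDl big_seq sumr_ge0// => l; rewrite mem_index_iota => /andP[_ lh].
  by apply: eta0; rewrite -ltnS (leq_trans lh).
have S0 h : (h <= m)%N -> 0 <= axis_sum eta h.
  by move=> hm; have := Sle 0%N h (leq0n _) hm; rewrite {1}/axis_sum big_geq.
have uw' : 0 <= u^-1 - w^-1 by rewrite subr_ge0 lef_pV2.
have wz' : 0 <= w^-1 - z^-1 by rewrite subr_ge0 lef_pV2.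
have exi : axis_sum eta i / u + path_weight eta qi <= lpp (two_rate_weight eta u v) m n.
  exact: lpp_ge_exit.
have Ski := Sle k i ki im.
(* c is the part of the x-axis sum that p collects *)
have key c : 0 <= c -> c <= axis_sum eta i ->
    forall g, g <= lpp (two_rate_weight eta z z) m n + (w^-1 - z^-1) * c ->
    g + (u^-1 - w^-1) * axis_sum eta k <= lpp (two_rate_weight eta u v) m n.
  move=> c0 cS g gle; apply: le_trans exi.
  have H1 : (u^-1 - w^-1) * axis_sum eta k <= (u^-1 - w^-1) * axis_sum eta i.
    exact: ler_wpM2l.
  have H2 : (w^-1 - z^-1) * c <= (w^-1 - z^-1) * axis_sum eta i by exact: ler_wpM2l.
  by rewrite Ei in gle; lra.
have [p Pp <-] := lpp_path (two_rate_weight eta w z) m n.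
have pz := path_weight_lpp (two_rate_weight eta z z) Pp.
have [[h [q [h0 Pq E]]]|E] := two_rate_path_split eta n0 Pp; last first.
  by apply: (key 0) => //; [exact: S0|rewrite mulr0 addr0 (E w z)].
have hm : (h <= m)%N by case: Pq => s [_ /up_right_path_le[+ _] lsE]; rewrite lsE.
rewrite E in pz; rewrite E; have [hi|ih] := leqP h i.
  by apply: (key (axis_sum eta h)); [exact: S0|exact: Sle|lra].
have H := lpp_ge_exit eta u v h0 Pq.
have Skh := Sle k h (leq_trans ki (ltnW ih)) hm.
have H1 : (u^-1 - w^-1) * axis_sum eta k <= (u^-1 - w^-1) * axis_sum eta h.
  exact: ler_wpM2l.
lra.
Qed.

End paths.

(** * Measurability of the exit points *)

Section measurability.
Context d (T : measurableType d) (R : realType).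

Lemma measurable_last_passage (w : T -> nat * nat -> R) u v :
  (forall x, measurable_fun setT (fun t => w t x)) ->
  measurable_fun setT (fun t => last_passage (w t) u v).
Proof.
move=> mw; have [l lE] := (finite_seqP _).1 (finite_up_right_paths u v).
have -> : (fun t => last_passage (w t) u v) =
    (fun t => \big[maxe/-oo%E]_(p <- l) (\sum_(x <- p) w t x)%:E).
  apply/funext => t; rewrite /last_passage lE.
  elim: (l) => [|p l' IH]; first by rewrite big_nil set_nil image_set0 ereal_sup0.
  rewrite big_cons -IH; apply/eqP; rewrite eq_le; apply/andP; split.
    apply: ge_ereal_sup => _ [q /= + <-]; rewrite inE => /orP[/eqP->|ql].
      by rewrite le_max lexx.
    by rewrite le_max ereal_sup_ubound ?orbT//; exists q.
  rewrite ge_max; apply/andP; split.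
    by apply: ereal_sup_ubound; exists p; rewrite //= mem_head.
  by apply: ereal_sup_le => _ [q ql <-]; exists q; rewrite //= inE ql orbT.
elim: l {lE} => [|p l IH].
  by under eq_fun do rewrite big_nil; exact: measurable_cst.
under eq_fun do rewrite big_cons; apply: measurable_maxe => //.
apply/measurable_EFinP; elim: p => [|x p IHp].
  by under eq_fun do rewrite big_nil; exact: measurable_cst.
by under eq_fun do rewrite big_cons; exact: measurable_funD.
Qed.

Variables (eta : nat * nat -> T -> R).
Hypothesis meta : forall x, measurable_fun setT (eta x).

Lemma measurable_exit_hor (z : R) m n :
  measurable_fun setT (fun t => exit_hor (eta ^~ t) z m n).
Proof.
have mw x : measurable_fun setT (fun t => boundary_weight (eta ^~ t) z x).
  by case: x => [[|i] [|j]] /=; [exact: measurable_cst|exact: measurable_funM|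
    exact: measurable_funM|exact: meta].
pose c i t := Ghat (eta ^~ t) z (0, 0)%N (m, n) ==
     (Ghat (eta ^~ t) z (0, 0)%N (i, 0)%N + Ghat (eta ^~ t) z (i, 1)%N (m, n)%N)%E.
have mG u v : measurable_fun setT (fun t => Ghat (eta ^~ t) z u v).
  exact: measurable_last_passage.
have mc i : measurable_fun setT (c i).
  rewrite /c; under eq_fun do rewrite eq_le.
  by apply: measurable_and; apply: measurable_fun_lee => //; exact: emeasurable_funD.
rewrite /exit_hor; elim: (index_iota 1 m.+1) => [|i r IH].
  by under eq_fun do rewrite big_nil; exact: measurable_cst.
under eq_fun do rewrite big_cons; apply: measurable_fun_ifT => //; first exact: mc.
exact: measurable_fun_maxn.
Qed.

Lemma measurable_nat_tail (f : T -> nat) (x : R) : measurable_fun setT f ->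
  measurable [set t | x <= (f t)%:R].
Proof.
move=> mf; have := mf measurableT [set k | x <= k%:R] I.
by rewrite setTI.
Qed.

End measurability.

(** * The exit event is covered by three tail events *)

Section tails.
Context d (T : measurableType d) (R : realType) (P : probability T R).

Lemma exp_markov (X : T -> R) (a : R) : measurable_fun setT X ->
  (P [set t | (a <= X t)%R] <= (expR (- a))%:E * \int[P]_t (expR (X t))%:E)%E.
Proof.
move=> mX.
have mA : measurable [set t | a <= X t].
  rewrite -[X in measurable X]setTI -[X in _ `&` X]preimage_itvcy.
  by have := mX measurableT `[a, +oo[%classic; exact.
have me : measurable_fun setT (fun t => (expR (X t))%:E).
  by apply/measurable_EFinP; exact: measurableT_comp.
rewrite -ge0_integralZl ?lee_fin ?expR_ge0//.
have -> : P [set t | a <= X t] = (\int[P]_t (\1_[set t | a <= X t] t)%:E)%E.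
  by rewrite integral_indic// setIT.
apply: ge0_le_integral => //.
- exact/measurable_EFinP.
- exact: emeasurable_funM.
move=> t _; rewrite -[leRHS]EFinM lee_fin -expRD indicE.
have [|_] := boolP (t \in _); last exact: expR_ge0.
by rewrite inE /= => aX; rewrite -expR0 ler_expR; lra.
Qed.

Variables (eta : nat * nat -> {RV P >-> R}).
Hypothesis iid : iid_exponential 1 eta.

Lemma axis_sum_mgf k :
  (\int[P]_t (expR (- axis_sum (fun x => eta x t) k))%:E = (2^-1 ^+ k)%:E)%E.
Proof.
pose s := [seq (l, 0)%N | l <- iota 1 k].
have us : uniq s by rewrite map_inj_uniq ?iota_uniq// => i j [].
have r0 (x : nat * nat) : 0 < 1 :> R by [].
have L0 : has_law P ([seq (fun t => eta x t / 1, 1) | x <- s] ++ [::]) setT 1%E.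
  by rewrite cats0; exact: (has_law_iid iid r0 us).
have ar (x : nat * nat) : -1 < 1 :> R by rewrite (@lt_trans _ _ 0)// oppr_lt0.
have [Q [L1 E]] := has_law_tilt_seq measurableT ar lee01 (isT : 1%E \is a fin_num) L0.
have M := has_law_mass L1.
have := E (cst 1%E) (measurable_cst _) (fun=> lee01).
rewrite integral_cst// mul1e M mule1 big_const_seq count_predT size_map size_iota.
rewrite iter_mulr_1 opprK div1r => ->.
apply: eq_integral => t _; rewrite mul1e; congr (expR _)%:E.
rewrite /axis_sum /index_iota subSS subn0 big_map -sumrN; apply: eq_bigr => l _.
by rewrite divr1 mulN1r.
Qed.

Lemma exponential_rv_lt0_null x : P [set t | eta x t < 0] = 0%E.
Proof.
have mA : measurable (`]-oo, 0[%classic : set R) by [].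
have := iid.2 x _ mA; rewrite exponential_probE// => E.
transitivity (P (eta x @^-1` `]-oo, 0[%classic)).
  by congr (P _); apply/seteqP; split => t /=; rewrite in_itv.
rewrite [LHS]E; apply: integral0_eq => y _; rewrite indicE.
have [|_] := boolP (y \in _); last by rewrite mul0e.
by rewrite inE/= in_itv/= => y0; rewrite lt0_exponential_pdf// mule0.
Qed.

(** Outside the null event that some axis weight is negative, if G(u, v) < M +
    A, G(w, z) > M - B and S_k > k / 4, then [exit_hor_comparison] rules out an
    exit at k or later, since A + B <= (1/u - 1/w) k / 4. The three summands
    are the exponential Markov bounds of the three complementary events, with
    exponents u - v, w - z and -1. *)
Lemma exit_hor_tail (u v w z A B M : R) m n k : (0 < n)%N -> (0 < k)%N ->
  0 < v -> v < u -> u <= w -> w < z -> z < 1 ->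
  A + B <= (u^-1 - w^-1) * (k%:R / 4) ->
  (P [set t | (k <= exit_hor (fun x => eta x t) z m n)%N] <=
   (expR (- ((u - v) * (M + A))) * ((u / v) ^+ m * ((1 - v) / (1 - u)) ^+ n) +
    expR ((z - w) * (M - B)) * ((w / z) ^+ m * ((1 - z) / (1 - w)) ^+ n) +
    expR (k%:R / 4) * 2^-1 ^+ k)%:E)%E.
Proof.
move=> n0 k0 v0 vu uw wz z1 AB.
have u0 : 0 < u by exact: lt_trans vu.
have w0 : 0 < w by exact: lt_le_trans uw.
have z0 : 0 < z by exact: lt_trans wz.
have w1 : w < 1 by exact: lt_trans z1.
have u1 : u < 1 by exact: le_lt_trans w1.
have v1 : v < 1 by exact: lt_trans u1.
pose Y1 t := (u - v) * lpp (two_rate_weight (fun x => eta x t) u v) m n.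
pose Y2 t := (w - z) * lpp (two_rate_weight (fun x => eta x t) w z) m n.
pose Y3 t := - axis_sum (fun x => eta x t) k.
pose E := [set t | (k <= exit_hor (fun x => eta x t) z m n)%N].
pose E0 := \big[setU/set0]_(l < m.+1) [set t | eta (l : nat, 0)%N t < 0].
pose E1 := [set t | (u - v) * (M + A) <= Y1 t].
pose E2 := [set t | (w - z) * (M - B) <= Y2 t].
pose E3 := [set t | - (k%:R / 4) <= Y3 t].
have mlpp a b : measurable_fun setT
    (fun t => lpp (two_rate_weight (fun x => eta x t) a b) m n).
  by apply: measurable_lpp => x; exact: measurable_two_rate_weight.
have mY1 : measurable_fun setT Y1 by exact: measurable_funM.
have mY2 : measurable_fun setT Y2 by exact: measurable_funM.
have mY3 : measurable_fun setT Y3.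
  apply: measurableT_comp => //; rewrite /axis_sum; elim: (index_iota _ _) => [|l r IH].
    by under eq_fun do rewrite big_nil; exact: measurable_cst.
  by under eq_fun do rewrite big_cons; exact: measurable_funD.
have mlt (X : T -> R) : measurable_fun setT X -> measurable [set t | X t < 0].
  move=> mX; have := mX measurableT `]-oo, 0[%classic (measurable_itv _).
  rewrite setTI => H; suff -> : [set t | X t < 0] = X @^-1` `]-oo, 0[%classic by [].
  by apply/seteqP; split => t /=; rewrite in_itv.
have mge (X : T -> R) a : measurable_fun setT X -> measurable [set t | a <= X t].
  move=> mX; have := mX measurableT `[a, +oo[%classic (measurable_itv _).
  rewrite setTI => H; suff -> : [set t | a <= X t] = X @^-1` `[a, +oo[%classic by [].
  by apply/seteqP; split => t /=; rewrite in_itv/= andbT.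
have mE0 : measurable E0 by apply: bigsetU_measurable => l _; exact: mlt.
have mE1 : measurable E1 by exact: mge.
have mE2 : measurable E2 by exact: mge.
have mE3 : measurable E3 by exact: mge.
have mE : measurable E.
  have H := measurable_nat_tail (k%:R : R)
    (measurable_exit_hor (fun x => measurable_funPT (eta x)) z m n).
  suff -> : E = [set t | k%:R <= (exit_hor (fun x => eta x t) z m n)%:R :> R] by [].
  by apply/seteqP; split => t /=; rewrite ler_nat.
have sub : E `<=` E0 `|` (E1 `|` (E2 `|` E3)).
  move=> t /= kex.
  have [?|n0'] := pselect (E0 t); first by left.
  right; have [?|/negP] := boolP ((u - v) * (M + A) <= Y1 t); first by left.
  move=> n1; right; have [?|/negP] := boolP ((w - z) * (M - B) <= Y2 t); first by left.
  move=> n2; right; rewrite /E3/= leNgt; apply/negP => n3.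
  have eta0 l : (l <= m)%N -> 0 <= eta (l, 0)%N t.
    move=> lm; rewrite leNgt; apply/negP => lt0; apply: n0'.
    rewrite /E0 -(bigcup_mkord m.+1 (fun l => [set t | eta (l, 0)%N t < 0])).
    by exists l; rewrite //= ltnS.
  have := exit_hor_comparison v n0 k0 u0 uw (ltW wz) eta0 kex.
  move/negP: n1; rewrite -ltNge ltr_pM2l ?subr_gt0// => n1.
  move/negP: n2; rewrite -ltNge ltr_nM2l ?subr_lt0// => n2.
  rewrite ltrN2 in n3.
  have uw' : 0 <= u^-1 - w^-1 by rewrite subr_ge0 lef_pV2.
  have H : (u^-1 - w^-1) * (k%:R / 4) <= (u^-1 - w^-1) * axis_sum (fun x => eta x t) k.
    by rewrite ler_wpM2l// ltW.
  lra.
have PE0 : P E0 = 0%E.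
  suff [] : measurable E0 /\ P E0 = 0%E by [].
  rewrite /E0; elim/big_ind : _ => [|F G [mF F0] [mG G0]|l _].
  - by split; [exact: measurable0|exact: measure0].
  - split; first exact: measurableU.
    have : (P (F `|` G) <= P F + P G)%E by exact: measureU2.
    by rewrite F0 G0 adde0 measure_le0 => /eqP.
  - by split; [exact: mlt|exact: exponential_rv_lt0_null].
apply: (@le_trans _ _ (P (E0 `|` (E1 `|` (E2 `|` E3))))).
  by apply: le_measure; rewrite ?inE//; do ?apply: measurableU.
apply: (le_trans (measureU2 P mE0 _)); first by do ?apply: measurableU.
rewrite [X in (X + _ <= _)%E]PE0 add0e.
apply: (le_trans (measureU2 P mE1 _)); first by do ?apply: measurableU.
rewrite -addrA EFinD; apply: leeD.
  apply: (le_trans (exp_markov _ mY1)).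
  by rewrite lpp_mgf// -EFinM.
apply: (le_trans (measureU2 P mE2 mE3)); rewrite EFinD; apply: leeD.
  apply: (le_trans (exp_markov _ mY2)).
  by rewrite lpp_mgf// -EFinM -mulNr opprB.
apply: (le_trans (exp_markov _ mY3)).
by rewrite axis_sum_mgf opprK -EFinM.
Qed.

End tails.

(** * Choice of the parameters *)

Section rate_function.
Context {R : realType}.

(** The mean value theorem for m ln x - n ln (1 - x), whose derivative m / x +
    n / (1 - x) is the mean of the stationary last-passage time. *)
Lemma mgf_mvt (a b : R) m n : 0 < a -> a < b -> b < 1 ->
  exists2 c, a < c < b &
    (b / a) ^+ m * ((1 - a) / (1 - b)) ^+ n =
    expR ((b - a) * (m%:R / c + n%:R / (1 - c))).
Proof.
move=> a0 ab b1.
have b0 : 0 < b by exact: lt_trans ab.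
have a1 : a < 1 by exact: lt_trans b1.
pose L : R -> R := m%:R \*: @ln R - n%:R \*: (@ln R \o (fun x => 1 - x)).
pose dL x : R := m%:R / x + n%:R / (1 - x).
have dLP (x : R) : 0 < x -> x < 1 -> is_derive x (1 : R) L (dL x).
  move=> x0 x1.
  have x1' : 0 < 1 - x by rewrite subr_gt0.
  have D1 := is_derive1_ln x0.
  have D2 := is_derive1_ln x1'.
  have D3 : is_derive x (1 : R) (fun y : R => 1 - y) (0 - 1).
    exact: (is_deriveB (is_derive_cst (1 : R) x 1) (is_derive_id x 1)).
  have D := is_deriveB (is_deriveZ m%:R D1) (is_deriveZ n%:R 
    (@is_derive1_comp R (@ln R) (fun y => 1 - y) x _ _ D2 D3)).
  apply: (is_derive_eq D).
  by rewrite /dL /GRing.scale/=; ring.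
have LE x : L x = m%:R * ln x - n%:R * ln (1 - x) by [].
have [|z|c] := @MVT R L dL a b ab.
- by move=> x; rewrite in_itv/= => /andP[ax xb]; apply: dLP;
    [exact: lt_trans ax|exact: lt_trans xb _].
- apply: derivable_within_continuous => x; rewrite in_itv/= => /andP[ax xb].
  by have D := dLP x (lt_le_trans a0 ax) (le_lt_trans xb b1); exact: ex_derive.
rewrite in_itv/= => cab E; exists c => //.
rewrite [(b - a) * _]mulrC -/(dL c) -E !LE.
have a1' : 0 < 1 - a by rewrite subr_gt0.
have b1' : 0 < 1 - b by rewrite subr_gt0.
rewrite [X in expR X](_ : _ = m%:R * (ln b - ln a) + n%:R * (ln (1 - a) - ln (1 - b)));
  last by ring.
by rewrite expRD !expRM_natl -!ln_div ?posrE// !lnK// posrE divr_gt0.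
Qed.

(** Completing the square: the mean of the stationary time is least at the
    characteristic direction zeta, and quadratic around it. *)
Lemma stationary_meanE (m n : nat) (c : R) : (0 < m)%N -> (0 < n)%N -> 0 < c -> c < 1 ->
  let M := (Num.sqrt m%:R + Num.sqrt n%:R) ^+ 2 in
  m%:R / c + n%:R / (1 - c) = M + M * (zeta m%:R n%:R - c) ^+ 2 / (c * (1 - c)).
Proof.
move=> m0 n0 c0 c1 M.
have sm : 0 < Num.sqrt (m%:R : R) by rewrite sqrtr_gt0 ltr0n.
have sn : 0 < Num.sqrt (n%:R : R) by rewrite sqrtr_gt0 ltr0n.
rewrite /M /zeta -{1}(@sqr_sqrtr R m%:R)// -{1}(@sqr_sqrtr R n%:R)//.
field.
by rewrite subr_eq0 !gt_eqF// addr_gt0.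
Qed.

Lemma mean_weight_le (m n : nat) :
  (Num.sqrt m%:R + Num.sqrt n%:R) ^+ 2 <= 2 * (m + n)%:R :> R.
Proof.
have hm := @sqr_sqrtr R m%:R (ler0n _ _); have hn := @sqr_sqrtr R n%:R (ler0n _ _).
rewrite natrD -{2}hm -{2}hn.
have := sqr_ge0 (Num.sqrt m%:R - Num.sqrt n%:R : R); nra.
Qed.

(** Combines M <= 2 (m + n) with c (1 - c) >= e^2 / 2. *)
Lemma stationary_mean_excess (m n : nat) (e c t : R) :
  (0 < m)%N -> (0 < n)%N -> 0 < e -> e / 2 <= c -> e <= 1 - c ->
  `|zeta m%:R n%:R - c| <= t ->
  m%:R / c + n%:R / (1 - c) <=
    (Num.sqrt m%:R + Num.sqrt n%:R) ^+ 2 + 4 * (m + n)%:R * t ^+ 2 / e ^+ 2.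
Proof.
move=> m0 n0 e0 ec ec' ct.
have c0 : 0 < c by apply: lt_le_trans ec; rewrite divr_gt0.
have c1 : 0 < 1 - c by exact: lt_le_trans ec'.
have c1' : c < 1 by rewrite -subr_gt0.
rewrite (stationary_meanE m0 n0 c0 c1')/= lerD2l.
rewrite ler_pdivrMr; last exact: mulr_gt0.
have cc : e ^+ 2 / 2 <= c * (1 - c).
  by rewrite expr2 mulrAC; apply: ler_pM => //; rewrite ?divr_ge0// ltW.
have d2 : (zeta m%:R n%:R - c) ^+ 2 <= t ^+ 2.
  by rewrite -(real_normK (num_real (_ - _))) ler_pXn2r// nnegrE// (le_trans _ ct).
apply: (@le_trans _ _ (2 * (m + n)%:R * t ^+ 2)).
  by apply: ler_pM => //; rewrite ?sqr_ge0// mean_weight_le.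
apply: (@le_trans _ _ (4 * (m + n)%:R * t ^+ 2 / e ^+ 2 * (e ^+ 2 / 2))).
  rewrite le_eqVlt; apply/orP; left; apply/eqP; field.
  by rewrite gt_eqF.
apply: ler_wpM2l => //; apply: divr_ge0; last exact: sqr_ge0.
by apply: mulr_ge0; [exact: mulr_ge0|exact: sqr_ge0].
Qed.

End rate_function.

(** Here q = (m + n)^(1/3) and e keeps zeta away from 0 and 1. With r = s / q
    and spacing a r, where a = (e / 32)^2, the points v < u < w < z lie within
    4 a r of zeta, and X = (m + n) r^2 = s^2 (m + n)^(1/3) is the scale of the
    deviations. The excess of the mean over M is at most X a / 16, so A = X a /
    8 leaves half of A to the right tail; the left tail has no excess to beat
    and B = X a^2 is enough. The gain (1/u - 1/w) k / 4 is at least X a / 4 >=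
    A + B. Multiplying by the exponent a r and using X r = s^3 makes each tail
    at most exp (- a^3 s^3). *)
Lemma exit_hor_cubic (R : realType) d (T : measurableType d)
    (P : probability T R) (eta : nat * nat -> {RV P >-> R}) (e s q z : R) m n k :
  iid_exponential 1 eta -> (0 < m)%N -> (0 < n)%N ->
  0 < e -> e < 1 -> e <= zeta m%:R n%:R -> zeta m%:R n%:R <= 1 - e ->
  0 < q -> q ^+ 3 = (m + n)%:R -> 0 < s -> s <= q ->
  `|z - zeta m%:R n%:R| <= (e / 32) ^+ 2 * (s / q) ->
  s * q ^+ 2 <= k%:R ->
  (P [set t | (k <= exit_hor (fun x => eta x t) z m n)%N] <=
    (3 * expR (- (((e / 32) ^+ 2) ^+ 3 * s ^+ 3)))%:E)%E.
Proof.
move=> iid m0 n0 e0 e1 ze ze' q0 qE s0 sq zz ks.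
(* e^2 = 32^2 a is what turns the bound 64 X a^2 / e^2 of the excess into X a / 16 *)
pose a : R := (e / 32) ^+ 2; pose r : R := s / q; pose X : R := s ^+ 2 * q.
pose M : R := (Num.sqrt m%:R + Num.sqrt n%:R) ^+ 2.
pose x0 := zeta (m%:R : R) n%:R.
rewrite -/a -/r -/x0 in zz ze ze' *.
have a0 : 0 < a by rewrite exprn_gt0// divr_gt0// ltr0Sn.
have e32 : e / 32 <= 1 by lra.
have r0 : 0 < r by rewrite divr_gt0.
have r1 : r <= 1 by rewrite ler_pdivrMr// mul1r.
have ae : a <= e / 32.
  by rewrite /a expr2 ler_piMr// ltW// divr_gt0// ltr0Sn.
have ar0 : 0 < a * r by rewrite mulr_gt0.
have are : a * r <= e / 32 by apply: le_trans ae; rewrite ler_piMr// ltW.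
have X0 : 0 <= X by rewrite mulr_ge0 ?exprn_ge0// ltW.
have NX : (m + n)%:R * r ^+ 2 = X.
  by rewrite -qE /r /X; field; rewrite gt_eqF.
have Xr : X * r = s ^+ 3 by rewrite /X /r; field; rewrite gt_eqF.
have s30 : 0 < s ^+ 3 by rewrite exprn_gt0.
pose w := z - a * r; pose u := w - a * r; pose v := u - a * r.
move: zz; rewrite ler_norml => /andP[zl zu].
have k0 : (0 < k)%N.
  by rewrite -(ltr0n R); apply: lt_le_trans ks; rewrite mulr_gt0// exprn_gt0.
have v0 : 0 < v by rewrite /v /u /w; lra.
have vu : v < u by rewrite /v; lra.
have uw : u <= w by rewrite /u; lra.
have wz : w < z by rewrite /w; lra.
have z1 : z < 1 by lra.
have w0 : 0 < w by rewrite /w; lra.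
have w1 : w < 1 by rewrite /w; lra.
have u0 : 0 < u by lra.
have u1 : u < 1 by lra.
have M0 : 0 <= M by exact: sqr_ge0.
have MN : M <= 2 * (m + n)%:R by exact: mean_weight_le.
pose A := X * a / 8; pose B := X * a ^+ 2.
have Xa : 0 <= X * a by rewrite mulr_ge0// ltW.
have a1 : a <= 1 / 32 by lra.
have AB : A + B <= (u^-1 - w^-1) * (k%:R / 4).
  have h1 : a * r <= u^-1 - w^-1.
    have -> : u^-1 - w^-1 = (a * r) / (u * w).
      have <- : w - u = a * r by rewrite /u; ring.
      by field; rewrite !gt_eqF.
    rewrite ler_pdivlMr ?mulr_gt0// ler_piMr ?(ltW ar0)//.
    by rewrite mulr_ile1 ?ltW.
  have h2 : a * r * (s * q ^+ 2 / 4) <= (u^-1 - w^-1) * (k%:R / 4).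
    apply: ler_pM => //; first exact: ltW.
      by rewrite divr_ge0// mulr_ge0 ?exprn_ge0// ltW.
    by rewrite ler_pM2r.
  apply: le_trans h2.
  have -> : a * r * (s * q ^+ 2 / 4) = X * a / 4.
    by rewrite /r /X; field; rewrite gt_eqF.
  have : B <= X * a / 32.
    by rewrite /B expr2 mulrA ler_wpM2l//; clear -a1; lra.
  rewrite /A; clear -Xa; lra.
have tail := @exit_hor_tail _ _ _ _ _ iid u v w z A B M m n k n0 k0 v0 vu uw wz z1 AB.
apply: (le_trans tail); rewrite lee_fin.
rewrite (_ : 3 * expR _ = expR (- (a ^+ 3 * s ^+ 3)) + expR (- (a ^+ 3 * s ^+ 3))
  + expR (- (a ^+ 3 * s ^+ 3))); last by ring.
have a3 : a ^+ 3 <= a ^+ 2 / 16.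
  by rewrite exprSr; apply: ler_wpM2l; [exact: sqr_ge0|clear -a1; lra].
apply: lerD; first apply: lerD.
- have [c /andP[vc cu] ->] := mgf_mvt m n v0 vu u1.
  rewrite -expRD ler_expR.
  have ce : e / 2 <= c by move: vc; rewrite /v /u /w; clear -zl ze are e0; lra.
  have ce' : e <= 1 - c by move: cu; rewrite /u /w; clear -zu ze' ar0; lra.
  have ct : `|zeta m%:R n%:R - c| <= 4 * (a * r).
    move: vc cu; rewrite ler_norml -/x0 /v /u /w; clear -zl zu ar0 => vc cu.
    by apply/andP; split; lra.
  have D := stationary_mean_excess m0 n0 e0 ce ce' ct.
  rewrite (_ : 4 * _ * _ / _ = X * a / 16) -/M in D; last first.
    by rewrite -NX /a; field; rewrite gt_eqF.
  rewrite (_ : u - v = a * r); last by rewrite /v; ring.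
  have h : a * r * (m%:R / c + n%:R / (1 - c)) <= a * r * (M + X * a / 16).
    by rewrite ler_wpM2l// ltW.
  have h' : a * r * (X * a / 16) = a ^+ 2 / 16 * s ^+ 3 by rewrite -Xr; ring.
  have h'' : a ^+ 3 * s ^+ 3 <= a ^+ 2 / 16 * s ^+ 3 by rewrite ler_wpM2r// ltW.
  rewrite /A; clear -h h' h''; lra.
- have [c /andP[wc cz] E] := mgf_mvt m n w0 wz z1.
  have c0 : 0 < c by exact: lt_trans wc.
  have c1 : c < 1 by exact: lt_trans z1.
  have -> : (w / z) ^+ m * ((1 - z) / (1 - w)) ^+ n =
      expR (- ((z - w) * (m%:R / c + n%:R / (1 - c)))).
    by rewrite expRN -E invfM -!exprVn !invf_div.
  rewrite -expRD ler_expR (stationary_meanE m0 n0 c0 c1)/= -/M -/x0.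
  rewrite (_ : z - w = a * r); last by rewrite /w; ring.
  have h : 0 <= (a * r) * (M * (x0 - c) ^+ 2 / (c * (1 - c))).
    apply: mulr_ge0; first exact: ltW.
    apply: divr_ge0; first by apply: mulr_ge0 => //; exact: sqr_ge0.
    by rewrite mulr_ge0 ?subr_ge0 ?ltW.
  have h' : a * r * B = a ^+ 3 * s ^+ 3 by rewrite /B -Xr; ring.
  rewrite -h'; set Q := M * _ / _ in h *.
  rewrite (_ : _ + _ = - (a * r * B) - a * r * Q); last by ring.
  by rewrite gerBl.
- have half : 2^-1 <= expR (- (1 / 2)) :> R.
    by apply: le_trans (expR_ge1Dx _); clear; lra.
  have h1 : 2^-1 ^+ k <= expR (- (1 / 2)) ^+ k :> R.
    by rewrite lerXn2r// ?nnegrE ?expR_ge0// invr_ge0.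
  apply: (@le_trans _ _ (expR (k%:R / 4) * expR (- (1 / 2)) ^+ k)).
    by rewrite ler_wpM2l// expR_ge0.
  rewrite -expRM_natl -expRD ler_expR.
  have sk : s ^+ 3 <= k%:R.
    apply: le_trans ks; rewrite exprS ler_wpM2l ?(ltW s0)//.
    by rewrite ler_pXn2r// nnegrE ltW.
  have a31 : a ^+ 3 <= 1 / 4.
    apply: (le_trans a3); rewrite expr2; clear -a0 a1; nra.
  have : a ^+ 3 * s ^+ 3 <= 1 / 4 * s ^+ 3 by rewrite ler_wpM2r// ltW.
  clear -sk; lra.
Qed.

(** * The theorem *)

Section final.
Context {R : realType}.

Lemma exit_hor_le eta (z : R) m n : (exit_hor eta z m n <= m)%N.
Proof.
rewrite /exit_hor big_seq_cond; apply/bigmax_leqP_seq => i _ /andP[].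
by rewrite mem_index_iota => /andP[_]; rewrite ltnS.
Qed.

Lemma zetaC (x y : R) : 0 < x -> 0 < y -> zeta y x = 1 - zeta x y.
Proof.
move=> x0 y0; have sx : 0 < Num.sqrt x by rewrite sqrtr_gt0.
have sy : 0 < Num.sqrt y by rewrite sqrtr_gt0.
by rewrite /zeta; field; rewrite !gt_eqF// addr_gt0.
Qed.

Lemma zeta_cone (delta x y : R) : 0 < delta -> cone delta (x, y) ->
  Num.sqrt delta / (1 + Num.sqrt delta) <= zeta x y.
Proof.
move=> d0 [/= x0 y0 dx _].
have sx : 0 < Num.sqrt x by rewrite sqrtr_gt0.
have sy : 0 < Num.sqrt y by rewrite sqrtr_gt0.
have sd : 0 < Num.sqrt delta by rewrite sqrtr_gt0.
have h : Num.sqrt delta * Num.sqrt y <= Num.sqrt x.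
  by rewrite -(sqrtrM _ (ltW d0)); exact: ler_wsqrtr.
rewrite /zeta ler_pdivrMr ?addr_gt0// mulrAC ler_pdivlMr ?addr_gt0//.
by rewrite mulrDr mulrDr mulr1 mulrC; lra.
Qed.

Lemma iid_exponential_swap d (T : measurableType d) (P : probability T R)
    (eta : nat * nat -> {RV P >-> R}) :
  iid_exponential 1 eta -> iid_exponential 1 (eta \o swap_pair).
Proof.
move=> [ind expo]; split; last by move=> i; exact: expo.
move=> J A uJ mA.
have sK := swap_pairK.
have := ind [seq swap_pair i | i <- J] (A \o swap_pair).
rewrite map_inj_uniq ?uJ; last exact: inv_inj.
move=> /(_ isT (fun i => mA _)); rewrite big_map.
under [X in _ = X -> _]eq_bigr => i _ do rewrite /= sK.
move=> <-; congr (P _); apply/seteqP; split => t /= H i /=.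
  by move=> /mapP[j jJ ->]; rewrite sK; exact: H.
move=> iJ; have := H (swap_pair i); rewrite /= sK; apply; exact: map_f.
Qed.

End final.

Theorem theorem2p5 (R : realType) :
  forall delta : R, 0 < delta ->
  exists c0 : R, 0 < c0 /\
  forall K : R, 0 <= K ->
  exists N0 s0 : R, 0 < N0 /\ 0 < s0 /\
  forall (d : measure_display) (T : measurableType d) (P : probability T R)
    (eta : nat * nat -> {RV P >-> R}),
    iid_exponential 1 eta ->
  forall (m n : nat) (s z : R),
    cone delta (m%:R, n%:R) -> N0 <= m%:R -> N0 <= n%:R ->
    s0 <= s ->
    0 < z -> z < 1 ->
    `|z - zeta m%:R n%:R| <= K * (m + n)%:R `^ (- (1 / 3)) ->
    (P [set t | (s * (m + n)%:R `^ (2 / 3) <=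
       (maxn (exit_hor (fun x => eta x t) z m n)
             (exit_ver (fun x => eta x t) z m n))%:R)%R]
     <= (expR (- (c0 * s ^+ 3))%R)%:E)%E.
Proof.
move=> delta delta0.
have sd : 0 < Num.sqrt delta by rewrite sqrtr_gt0.
pose e := Num.sqrt delta / (1 + Num.sqrt delta).
have e0 : 0 < e by rewrite divr_gt0// addr_gt0.
have e1 : e < 1 by rewrite ltr_pdivrMr ?addr_gt0// mul1r ltrDr.
pose a := (e / 32) ^+ 2.
have a0 : 0 < a by rewrite exprn_gt0// divr_gt0// ltr0Sn.
have a30 : 0 < a ^+ 3 by rewrite exprn_gt0.
(* half of the exponent a^3 absorbs the factor 6 from the three tails of the two axes *)
exists (a ^+ 3 / 2); split; first by rewrite divr_gt0.
(* s >= K / a puts z within a s (m + n)^(-1/3) of zeta; s >= 3 / a gives a^3 s^3 >= 27 *)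
move=> K K0; exists 1, (K / a + 3 / a + 1); split => //.
have Ka : 0 <= K / a by rewrite divr_ge0// ltW.
have a3' : 0 < 3 / a by rewrite divr_gt0.
split; first lra.
move=> d T P eta iid m n s z cn m1 n1 s0s z0 z1 zz.
have m0 : (0 < m)%N by rewrite -(ler_nat R).
have n0 : (0 < n)%N by rewrite -(ler_nat R).
have N0 : 0 < (m + n)%:R :> R by rewrite ltr0n addn_gt0 m0.
pose q : R := (m + n)%:R `^ (1 / 3).
have q0 : 0 < q by rewrite powR_gt0.
have qE : q ^+ 3 = (m + n)%:R.
  by rewrite -powR_mulrn ?powR_ge0// -powRrM divfK// powRr1// ltW.
have q2E : (m + n)%:R `^ (2 / 3) = q ^+ 2.
  by rewrite -powR_mulrn ?powR_ge0// -powRrM; congr (_ `^ _); field.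
have s0 : 0 < s by lra.
have as3 : 3 <= a * s.
  by rewrite mulrC -ler_pdivrMr//; lra.
have Kas : K <= a * s by rewrite mulrC -ler_pdivrMr//; lra.
rewrite q2E.
set E := [set t | _].
have [sq|qs] := leP s q; last first.
  (* exit points are at most m + n = q^3, so the event is empty *)
  rewrite (_ : E = set0) ?measure0 ?lee_fin ?expR_ge0//.
  apply/seteqP; split => t //=; rewrite /E/= leNgt => /negP; apply.
  apply: (@le_lt_trans _ _ (q ^+ 3)).
    rewrite qE ler_nat geq_max exit_ver_swap.
    by rewrite (leq_trans (exit_hor_le _ _ _ _))/= ?leq_addr//
       (leq_trans (exit_hor_le _ _ _ _)) ?leq_addl.
  by rewrite exprS ltr_pM2r// exprn_gt0.
have [k sk kmin] : exists2 k : nat, s * q ^+ 2 <= k%:R &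
    forall l : nat, s * q ^+ 2 <= l%:R -> (k <= l)%N.
  have ex : exists k, s * q ^+ 2 <= k%:R.
    exists (Num.truncn (s * q ^+ 2)).+1; apply: ltW.
    exact: truncnS_gt.
  by have [k kP kmin] := ex_minnP ex; exists k.
pose eta' := eta \o swap_pair.
pose Eh := [set t | (k <= exit_hor (fun x => eta x t) z m n)%N].
pose Ev := [set t | (k <= exit_hor (fun x => eta' x t) (1 - z) n m)%N].
have zz' : `|z - zeta m%:R n%:R| <= a * (s / q).
  apply: (le_trans zz); rewrite powRN -/q mulrA.
  by apply: ler_wpM2r => //; rewrite invr_ge0 ltW.
have mR : 0 < m%:R :> R by rewrite ltr0n.
have nR : 0 < n%:R :> R by rewrite ltr0n.
have ze : e <= zeta m%:R n%:R by exact: zeta_cone.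
have ze' : e <= zeta n%:R m%:R.
  by apply: zeta_cone => //; case: cn.
have zC := zetaC mR nR.
have Ph : (P Eh <= (3 * expR (- (a ^+ 3 * s ^+ 3)))%:E)%E.
  apply: (exit_hor_cubic iid (q := q)) => //; lra.
have Pv : (P Ev <= (3 * expR (- (a ^+ 3 * s ^+ 3)))%:E)%E.
  apply: (exit_hor_cubic (iid_exponential_swap iid) (q := q)) => //.
  - by lra.
  - by rewrite addnC.
  - rewrite zC (_ : 1 - z - _ = - (z - zeta m%:R n%:R)) ?normrN//; ring.
have mtail (xi : nat * nat -> {RV P >-> R}) (y : R) i j (x : R) :
    measurable [set t | x <= (exit_hor (fun p => xi p t) y i j)%:R].
  exact: measurable_nat_tail (measurable_exit_hor (fun p => measurable_funPT (xi p)) y i j).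
have mk (xi : nat * nat -> {RV P >-> R}) (y : R) i j :
    measurable [set t | (k <= exit_hor (fun p => xi p t) y i j)%N].
  rewrite (_ : [set t | _] = [set t | k%:R <= (exit_hor (fun p => xi p t) y i j)%:R :> R]).
    exact: mtail.
  by apply/seteqP; split => t /=; rewrite ler_nat.
have EE : E = Eh `|` Ev.
  rewrite /E; apply/seteqP; split => t /=.
    by move=> /kmin; rewrite leq_max exit_ver_swap => /orP[]; [left|right].
  move=> H; apply: (le_trans sk); rewrite ler_nat leq_max exit_ver_swap.
  by case: H => H; apply/orP; [left|right].
rewrite EE; have : (P (Eh `|` Ev) <= P Eh + P Ev)%E by apply: measureU2; exact: mk.
move=> /le_trans; apply; apply: (le_trans (leeD Ph Pv)).
rewrite -EFinD lee_fin.
set X := a ^+ 3 * s ^+ 3.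
have X27 : 27 <= X.
  rewrite /X -exprMn (_ : 27 = 3 ^+ 3); last by ring.
  by rewrite lerXn2r// nnegrE; clear -as3; lra.
rewrite (_ : - (a ^+ 3 / 2 * s ^+ 3) = X / 2 - X); last by rewrite /X; field.
rewrite expRD -mulrDl ler_wpM2r ?expR_ge0//.
by apply: le_trans (expR_ge1Dx _); clear -X27; lra.
Qed.
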